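(* Let $Y_1,\ldots,Y_n$ be independent, identically distributed random vectors in $\mathbb{R}^k$ with $$\mathbb{E}(Y_i)=0,\qquad \mathbb{E}(Y_iY_i^T)=I_k .$$ Let $W=\frac{1}{\sqrt n}\sum_{i=1}^nY_i$ and let $Z$ be a standard Gaussian random vector in $\mathbb{R}^k$. Then for any $g\in C^2_o(\mathbb{R}^k)$, $$\left|\mathbb{E}g(W)-\mathbb{E}g(Z)\right|\le\frac{M_1(g)}{2\sqrt n}\sqrt{\mathbb{E}|Y_1|^4-k}+\frac{\sqrt{2\pi}}{3\sqrt n}\,M_2(g)\,\mathbb{E}|Y_1|^3 .$$
   Context: $|\cdot|$ is the Euclidean norm; $I_k$ is the $k\times k$ identity matrix; $C_o^2(\mathbb{R}^k)$ is the space of twice continuously differentiable real-valued functions on $\mathbb{R}^k$ with compact support. $$M_1(g)=\sup_{x\ne y}\frac{|g(x)-g(y)|}{|x-y|},\qquad M_2(g)=\sup_{x\neq y}\frac{|\nabla g(x)-\nabla g(y)|}{|x-y|}.$$ The bound has content only when $\mathbb{E}|Y_1|^4<\infty$. *)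

(* Defs.v *)
From HB Require Import structures.
From mathcomp Require Export all_boot all_order all_algebra.
From mathcomp Require Export all_classical all_reals all_analysis.

Set Implicit Arguments.
Unset Strict Implicit.
Unset Printing Implicit Defensive.

Export Order.TTheory GRing.Theory Num.Theory.
Export numFieldNormedType.Exports.

Local Open Scope classical_set_scope.
Local Open Scope ring_scope.

(* Matrices carry the Borel sigma-algebra.  The library topology on 'M[R]_(m, n)
   comes from the sup norm; its open sets are the Euclidean ones. *)
HB.instance Definition _ (R : realType) (m n : nat) :=
  @isMeasurable.Build (sigma_display (@open 'M[R]_(m, n))) 'M[R]_(m, n)
    <<s @open 'M[R]_(m, n) >>
    (@sigma_algebra0 _ setT _) (@sigma_algebraC _ _)
    (@sigma_algebra_bigcup _ setT _).

(* The norm `|x| of the library on 'rV[R]_k is the sup norm. *)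
Definition enorm (R : realType) (k : nat) (x : 'rV[R]_k) : R :=
  Num.sqrt (\sum_(j < k) x 0 j ^+ 2).

Definition gradient (R : realType) (k : nat) (g : 'rV[R]_k -> R)
    (x : 'rV[R]_k) : 'rV[R]_k :=
  \row_(j < k) 'D_(delta_mx 0 j) g x.

(* 'J (gradient g) is the Hessian matrix of g. *)
Definition C2 (R : realType) (k : nat) (g : 'rV[R]_k -> R) : Prop :=
  [/\ forall x, differentiable g x,
      forall x, differentiable (gradient g) x
    & continuous (fun x => 'J (gradient g) x)].

Definition C2o (R : realType) (k : nat) (g : 'rV[R]_k -> R) : Prop :=
  C2 g /\ compact (closure [set x | g x != 0]).

Definition M1 (R : realType) (k : nat) (g : 'rV[R]_k -> R) : \bar R :=
  ereal_sup [set (`|g p.1 - g p.2| / enorm (p.1 - p.2))%:E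
            | p in [set p : 'rV[R]_k * 'rV[R]_k | p.1 != p.2]].

Definition M2 (R : realType) (k : nat) (g : 'rV[R]_k -> R) : \bar R :=
  ereal_sup [set (enorm (gradient g p.1 - gradient g p.2)
                    / enorm (p.1 - p.2))%:E
            | p in [set p : 'rV[R]_k * 'rV[R]_k | p.1 != p.2]].

Definition mutually_independent (R : realType) (d d' : measure_display)
    (T : measurableType d) (T' : measurableType d') (P : probability T R)
    (I : finType) (X : I -> T -> T') : Prop :=
  forall (J : {set I}) (B : I -> set T'),
    (forall i, measurable (B i)) ->
    P (\bigcap_(i in [set` J]) (X i @^-1` B i)) =
    (\prod_(i in J) P (X i @^-1` B i))%E.

Definition identically_distributed (R : realType) (d d' : measure_display)
    (T : measurableType d) (T' : measurableType d') (P : probability T R)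
    (I : Type) (X : I -> T -> T') : Prop :=
  forall (i j : I) (B : set T'), measurable B ->
    P (X i @^-1` B) = P (X j @^-1` B).

(* 'E_P is extended-real valued, and is -oo when the positive and negative
   parts both have infinite integral, so for measurable X this forces every
   entry of X to be integrable. *)
Definition has_mean (R : realType) (d : measure_display)
    (T : measurableType d) (P : probability T R) (p q : nat)
    (X : T -> 'M[R]_(p, q)) (m : 'M[R]_(p, q)) : Prop :=
  forall a b, ('E_P[fun t => X t a b] = (m a b)%:E)%E.

Definition standard_gaussian (R : realType) (d : measure_display)
    (T : measurableType d) (P : probability T R) (k : nat)
    (Z : T -> 'rV[R]_k) : Prop :=
  mutually_independent P (fun (j : 'I_k) t => Z t 0 j) /\
  forall (j : 'I_k) (B : set R), measurable B ->
    P ((fun t => Z t 0 j) @^-1` B) = normal_prob 0 1 B.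

(* Main.v *)
(* Let [X_t = sin t * W + cos t * Z], so that [t |-> E g (X_t)] interpolates
   between [E g Z] and [E g W].  With [s = sin t], [c = cos t], [G] the gradient
   of [g], [F w = E G (s w + c Z)], [K_ij w = E Z_i G_j (s w + c Z)] and
   [tau = tr K], its derivative is [E (c W . F W - s tau W)].  Gaussian
   integration by parts and the Taylor estimate of [g] show that
   [c (F (w + u) - F w) . u] equals both [s u K(w) u^T] and [s u K(w + u) u^T] up
   to an error [s ^ 2 M2 |u| ^ 3 / 2].  Write [W] as the sum of the independent
   [U_i = Y_i / sqrt n], and [V_i = W - U_i].

   Applied at [V_i], this turns [c E W . F W] into [s E tau V_i] by independence,
   and [tau] is Lipschitz.  Applied at [W], it turns [c E W . F W] into
   [s E <sum_i U_i^T U_i, K W>], and [|<D, K>| <= M1 |D|] bounds the difference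
   with [s E tau W] by the variance of the empirical covariance.  The average of
   the two bounds, integrated over [0, pi / 2], gives the theorem, because
   [k <= E |Y_1| ^ 3] and [pi / 4 <= sqrt (2 pi) / 3]. *)
From HB Require Import structures.
Require Import Defs.
From mathcomp Require Import measurable_realfun ring lra.

Set Implicit Arguments.
Unset Strict Implicit.
Unset Printing Implicit Defensive.

Local Open Scope classical_set_scope.
Local Open Scope ring_scope.

(** * Euclidean norm *)

Section Euclid.
Context {R : realType} {k : nat}.
Implicit Types (u v w x y : 'rV[R]_k) (a b : R).

(** Each of the two bounds alone is too weak. Up to the common factor [1 / sqrt n] and after
    integration over the quarter circle, the one at [V_i] has no [M1] term, but its factor of [M2]
    is [pi / 4 * (E |Y_1| ^ 3 / 2 + k)], possibly as large as [3 pi / 8 * E |Y_1| ^ 3], which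
    exceeds the allowed [sqrt (2 pi) / 3 * E |Y_1| ^ 3]. The one at [W] has only
    [pi / 8 * E |Y_1| ^ 3] there, but twice the allowed [M1] term. The average halves the [M1] term
    and leaves [pi / 8 * (E |Y_1| ^ 3 + k)].

    The obstacle is that [M1] and [M2] give no control on how the Hessian of [g] varies. Integration
    by parts leaves a single gradient in [K], so that [M1] bounds [K] and [M2] bounds its Lipschitz
    constant. The same identity turns increments of [F] into increments of [g] weighted by a
    coordinate of [Z], to which a second-order Taylor bound applies. Matrices are measured in the
    Frobenius norm, because [E |Z M| ^ 2] is exactly its square and no dimensional constant is
    lost. *)

Definition dotv u v : R := \sum_(j < k) u 0 j * v 0 j.

Lemma dotvC u v : dotv u v = dotv v u.
Proof. by apply: eq_bigr => j _; rewrite mulrC. Qed.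

Lemma dotvDl u v w : dotv (u + v) w = dotv u w + dotv v w.
Proof. by rewrite -big_split; apply: eq_bigr => j _; rewrite mxE mulrDl. Qed.

Lemma dotvZl a u v : dotv (a *: u) v = a * dotv u v.
Proof. by rewrite mulr_sumr; apply: eq_bigr => j _; rewrite mxE mulrA. Qed.

Lemma dotvDr u v w : dotv u (v + w) = dotv u v + dotv u w.
Proof. by rewrite ![dotv u _]dotvC dotvDl. Qed.

Lemma dotvZr a u v : dotv u (a *: v) = a * dotv u v.
Proof. by rewrite ![dotv u _]dotvC dotvZl. Qed.

Lemma dotvNl u v : dotv (- u) v = - dotv u v.
Proof. by rewrite -scaleN1r dotvZl mulN1r. Qed.

Lemma dotvBl u v w : dotv (u - v) w = dotv u w - dotv v w.
Proof. by rewrite dotvDl dotvNl. Qed.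

Lemma dotvBr u v w : dotv u (v - w) = dotv u v - dotv u w.
Proof. by rewrite ![dotv u _]dotvC dotvBl. Qed.

Lemma dotv_ge0 u : 0 <= dotv u u.
Proof. by apply: sumr_ge0 => j _; rewrite -expr2 sqr_ge0. Qed.

Lemma enormE u : enorm u = Num.sqrt (dotv u u).
Proof. by congr Num.sqrt; apply: eq_bigr => j _; rewrite expr2. Qed.

Lemma sqr_enorm u : enorm u ^+ 2 = dotv u u.
Proof. by rewrite enormE sqr_sqrtr ?dotv_ge0. Qed.

Lemma enorm_ge0 u : 0 <= enorm u.
Proof. exact: sqrtr_ge0. Qed.

Lemma enorm_eq0 u : enorm u = 0 -> u = 0.
Proof.
move=> /eqP; rewrite sqrtr_eq0 => h.
have /eqP := le_anti (introT andP (conj h (sumr_ge0 _ (fun j _ => sqr_ge0 (u 0 j))))).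
rewrite psumr_eq0 => [/allP h0|j _]; last exact: sqr_ge0.
apply/rowP => j; rewrite mxE; apply/eqP.
by have := h0 j (mem_index_enum j); rewrite /= sqrf_eq0.
Qed.

(** Cauchy-Schwarz: expand the squared norm of [|v| u - e |u| v] for the two signs [e] with
    [e ^ 2 = 1]. *)
Lemma dotv_le u v : `|dotv u v| <= enorm u * enorm v.
Proof.
have [/enorm_eq0 ->|u0] := eqVneq (enorm u) 0.
  rewrite /dotv big1 ?normr0 ?mulr_ge0 ?enorm_ge0// => j _.
  by rewrite mxE mul0r.
have [/enorm_eq0 ->|v0] := eqVneq (enorm v) 0.
  rewrite /dotv big1 ?normr0 ?mulr_ge0 ?enorm_ge0// => j _.
  by rewrite mxE mulr0.
have up : 0 < enorm u by rewrite lt_def u0 enorm_ge0.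
have vp : 0 < enorm v by rewrite lt_def v0 enorm_ge0.
have H (e : R) : e ^+ 2 = 1 -> e * dotv u v <= enorm u * enorm v.
  move=> e1; have := dotv_ge0 (enorm v *: u - (e * enorm u) *: v).
  rewrite !(dotvBl, dotvBr, dotvZl, dotvZr) -!sqr_enorm (dotvC v u).
  move=> h; rewrite -(ler_pM2l (mulr_gt0 up vp)).
  set D := dotv u v in h *; set a := enorm u in up h *; set b := enorm v in vp h *.
  have e2 : e * a * (e * a * b ^+ 2) = a ^+ 2 * b ^+ 2.
    by transitivity (e ^+ 2 * (a ^+ 2 * b ^+ 2)); [ring|rewrite e1 mul1r].
  have : e * a * (b * D - e * a * b ^+ 2) = e * a * (b * D) - a ^+ 2 * b ^+ 2.
    by rewrite -e2; ring.
  by move=> E; move: h; rewrite E; lra.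
rewrite ler_norml; apply/andP; split.
  by have := H (-1) ltac:(by rewrite sqrrN expr1n); lra.
by have := H 1 (expr1n _ 2); lra.
Qed.

Lemma enormZ a u : enorm (a *: u) = `|a| * enorm u.
Proof.
rewrite enormE dotvZl dotvZr mulrA -expr2 sqrtrM ?sqr_ge0// sqrtr_sqr.
by rewrite -enormE.
Qed.

Lemma enormN u : enorm (- u) = enorm u.
Proof. by rewrite -scaleN1r enormZ normrN1 mul1r. Qed.

Lemma enorm0 : enorm (0 : 'rV[R]_k) = 0.
Proof. by rewrite -(scale0r 0) enormZ normr0 mul0r. Qed.

Lemma enorm_triangle u v : enorm (u + v) <= enorm u + enorm v.
Proof.
rewrite -(@ler_pXn2r _ 2) ?nnegrE ?addr_ge0 ?enorm_ge0//.
rewrite sqr_enorm dotvDl !dotvDr -!sqr_enorm (dotvC v u).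
have := dotv_le u v; rewrite ler_norml => /andP[_ h].
by rewrite sqrrD mulr2n; lra.
Qed.

Lemma coord_le_enorm u j : `|u 0 j| <= enorm u.
Proof.
rewrite -sqrtr_sqr ler_wsqrtr// (bigD1 j)//= lerDl.
by apply: sumr_ge0 => i _; exact: sqr_ge0.
Qed.

Lemma enorm_le_sum u : enorm u <= \sum_(j < k) `|u 0 j|.
Proof.
rewrite -(@ler_pXn2r _ 2) ?nnegrE ?enorm_ge0 ?sumr_ge0//.
rewrite sqr_enorm [leRHS]expr2 mulr_suml; apply: ler_sum => j _.
rewrite -expr2 -real_normK ?num_real// expr2 ler_wpM2l//.
by rewrite (bigD1 j)//= lerDl sumr_ge0.
Qed.

Lemma coord_le_norm u j : `|u 0 j| <= `|u|.
Proof.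
rewrite [leRHS]/Num.norm /= mx_normrE; apply/bigmax_geP; right => /=.
by exists (0, j).
Qed.

(** Bridge to the library topology, which comes from the sup norm: it makes Euclidean Lipschitz
    functions continuous. *)
Lemma enorm_le_norm u : enorm u <= k%:R * `|u|.
Proof.
apply: (le_trans (enorm_le_sum u)).
rewrite -[X in X%:R]card_ord mulr_natl -sumr_const.
apply: ler_sum => j _; exact: coord_le_norm.
Qed.

End Euclid.

(** * First-order Taylor estimates *)

(** The mean value theorem for [B \- f]. It takes the place of integrating [f' <= B']: giving a
    primitive [B] of the bound is enough. *)
Lemma increment_le (R : realType) (f f' B B' : R -> R) (a b : R) : a <= b ->
  (forall x : R, is_derive x (1 : R) f (f' x)) ->
  (forall x : R, is_derive x (1 : R) B (B' x)) ->
  (forall x, a <= x <= b -> f' x <= B' x) ->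
  f b - f a <= B b - B a.
Proof.
move=> ab df dB fB.
have dfB (x : R) : is_derive x (1 : R) (B \- f) (B' x - f' x) by exact: is_deriveB.
have cBf : {within `[a, b], continuous (B \- f)}.
  apply: derivable_within_continuous => x _.
  exact: (@ex_derive _ _ _ _ _ _ _ (dfB x)).
have [c] := @MVT_segment R (B \- f) (fun x => B' x - f' x) a b ab
  (fun x _ => dfB x) cBf.
rewrite in_itv/= => cab E; rewrite -subr_ge0.
have -> : B b - B a - (f b - f a) = (B \- f) b - (B \- f) a by rewrite /=; ring.
by rewrite E mulr_ge0 ?subr_ge0 ?fB.
Qed.

Section Gradient.
Context {R : realType} {k : nat}.
Implicit Types (u v x y : 'rV[R]_k) (g : 'rV[R]_k -> R).

Lemma derive_gradient g x u : differentiable g x ->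
  'D_u g x = dotv (gradient g x) u.
Proof.
move=> dg; rewrite deriveE//.
rewrite {1}[u]row_sum_delta linear_sum; apply: eq_bigr => j _.
by rewrite linearZ/= mxE deriveE// mulrC.
Qed.

Lemma is_derive_line g x u (r : R) : differentiable g (x + r *: u) ->
  is_derive r (1 : R) (fun t : R => g (x + t *: u)) (dotv (gradient g (x + r *: u)) u).
Proof.
move=> dg.
have E : (fun h : R => h^-1 *: (g (x + (h *: (1 : R) + r) *: u) - g (x + r *: u)))
    = (fun h : R => h^-1 *: (g (h *: u + (x + r *: u)) - g (x + r *: u))).
  apply/funext => h; congr (_ *: (g _ - _)).
  by rewrite scalerDl addrCA; congr (_ *: _ + _); rewrite -[LHS]/(h * 1) mulr1.
apply: DeriveDef.
  by rewrite /derivable E; exact: (diff_derivable dg).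
by rewrite -derive_gradient// /derive E.
Qed.

Section Lipschitz.
Variables (g : 'rV[R]_k -> R) (L : R).
Hypothesis dg : forall x, differentiable g x.

Lemma bounded_gradient_lipschitz x y :
  (forall x, enorm (gradient g x) <= L) -> `|g x - g y| <= L * enorm (x - y).
Proof.
move=> gL.
have dl (r : R) := is_derive_line (dg (y + r *: (x - y))).
have gb r : `|dotv (gradient g (y + r *: (x - y))) (x - y)| <= L * enorm (x - y).
  by apply: (le_trans (dotv_le _ _)); rewrite ler_wpM2r ?enorm_ge0.
have idd (c r : R) : is_derive r (1 : R) (fun t : R => c * t) c.
  by apply: is_derive_eq; rewrite scaler1.
have ndl (r : R) := is_deriveN (dl r).
have := @increment_le R _ _ _ _ 0 1 ler01 dl (idd (L * enorm (x - y)))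
  (fun r _ => le_trans (ler_norm _) (gb r)).
have := @increment_le R _ _ _ _ 0 1 ler01 ndl (idd (L * enorm (x - y)))
  (fun r _ => le_trans (ler_norm _) (eq_ind_r (fun z => z <= _) (gb r) (normrN _))).
rewrite /= -[(- _) 1]/(- _) -[(- _) 0]/(- _).
rewrite !scale1r !scale0r addr0 (addrC y) subrK mulr1 mulr0 subr0 => h1 h2.
by rewrite ler_norml; apply/andP; split; [move: h1|move: h2]; lra.
Qed.

Hypothesis lipG : forall x y,
  enorm (gradient g x - gradient g y) <= L * enorm (x - y).

(** Along the segment, the derivative stays within [L |u| ^ 2 r] of its initial value; a quadratic
    majorant integrates this to the constant [L / 2]. The lower bound is the upper one for [- g]. *)
Lemma taylor_lipschitz_gradient x u :
  `|g (x + u) - g x - dotv (gradient g x) u| <= L / 2 * enorm u ^+ 2.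
Proof.
have dl (r : R) := is_derive_line (dg (x + r *: u)).
have gb (r : R) : 0 <= r <= 1 ->
    `|dotv (gradient g (x + r *: u)) u - dotv (gradient g x) u|
    <= L * enorm u ^+ 2 * r.
  move=> /andP[r0 _]; rewrite -dotvBl; apply: (le_trans (dotv_le _ _)).
  have -> : L * enorm u ^+ 2 * r = L * enorm (x + r *: u - x) * enorm u.
    by rewrite addrAC subrr add0r enormZ ger0_norm//; ring.
  by rewrite ler_wpM2r ?enorm_ge0.
set c := dotv (gradient g x) u.
have dB (a b r : R) : is_derive r (1 : R) (fun t : R => a * t + b * t ^+ 2)
    (a + 2 * b * r).
  apply: is_derive_eq; rewrite /GRing.scale/=; ring.
have ndl (r : R) := is_deriveN (dl r).
have := @increment_le R _ _ _ _ 0 1 ler01 dl (dB c (L / 2 * enorm u ^+ 2)).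
have := @increment_le R _ _ _ _ 0 1 ler01 ndl (dB (- c) (L / 2 * enorm u ^+ 2)).
rewrite /= -[(- _) 1]/(- _) -[(- _) 0]/(- _).
rewrite !scale1r !scale0r addr0 => h1 h2.
have {}h1 := h1 (fun r r01 => ltac:(have := gb r r01; rewrite ler_norml -/c; lra)).
have {}h2 := h2 (fun r r01 => ltac:(have := gb r r01; rewrite ler_norml -/c; lra)).
rewrite ler_norml; lra.
Qed.

(** A unit step in the direction of the gradient changes [g] by at least [|v| - L / 2] and by at
    most [2 B]. This is how a bounded [g] with finite [M2] gets a finite [M1]. *)
Lemma bounded_gradient B : 0 <= L -> (forall x, `|g x| <= B) ->
  forall x, enorm (gradient g x) <= 2 * B + L / 2.
Proof.
move=> L0 gB x; set v := gradient g x.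
have B0 := le_trans (normr_ge0 _) (gB x).
have [->|v0] := eqVneq (enorm v) 0; first by rewrite addr_ge0 ?mulr_ge0 ?divr_ge0.
have vp : 0 < enorm v by rewrite lt_def v0 enorm_ge0.
have := taylor_lipschitz_gradient x ((enorm v)^-1 *: v).
rewrite dotvZr enormZ [`|(enorm v)^-1|]ger0_norm ?invr_ge0 ?enorm_ge0//.
rewrite mulVf// expr1n mulr1.
rewrite -sqr_enorm expr2 mulKf//.
have := gB x; have := gB (x + (enorm v)^-1 *: v).
rewrite !ler_norml; lra.
Qed.

End Lipschitz.
End Gradient.

(** * Borel sets of row vectors and independence *)

Lemma continuous_measurable_matrix (R : realType) (m n : nat)
    (f : 'M[R]_(m, n) -> R) : continuous f -> measurable_fun setT f.
Proof.
move=> /continuousP cf.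
apply: (@measurability _ _ _ _ setT f (@RGenOpens.G R)).
  exact: RGenOpens.measurableE.
move=> _ [_ [a [b ->]] <-]; rewrite setTI; apply: sub_sigma_algebra; apply: cf.
exact: interval_open.
Qed.

Lemma measurable_coord (R : realType) (k : nat) d (T : measurableType d)
    (X : T -> 'rV[R]_k) j :
  measurable_fun setT X -> measurable_fun setT (fun t => X t 0 j).
Proof.
move=> mX; apply: (@measurableT_comp _ _ _ _ _ _ (fun x : 'rV[R]_k => x 0 j) _ X) => //.
by apply: continuous_measurable_matrix => x; exact: coord_continuous.
Qed.

(** An open set is the countable union of the rational balls that it contains, and a sup-norm ball
    is a finite intersection of conditions on the coordinates. *)
Lemma measurable_rV (R : realType) (k : nat) d (T : measurableType d)
    (X : T -> 'rV[R]_k) :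
  (forall j, measurable_fun setT (fun t => X t 0 j)) -> measurable_fun setT X.
Proof.
move=> mX; apply: (@measurability _ _ _ _ setT X (@open 'rV[R]_k)) => //.
move=> _ [A oA <-]; rewrite setTI.
pose c (p : 'rV[rat]_k * rat) : 'rV[R]_k := map_mx (@ratr R) p.1.
pose F p : set T :=
  if `[< ball (c p) (ratr p.2) `<=` A >] then X @^-1` (ball (c p) (ratr p.2))
  else set0.
have -> : X @^-1` A = \bigcup_p F p.
  apply/seteqP; split => t; last first.
    by move=> [p _]; rewrite /F; case: ifPn => // /asboolP sub /sub.
  move=> /= At; have /nbhs_ballP[r /= r0 rA] := open_nbhs_nbhs (conj oA At).
  (* With [q < r / 2], a ball of radius [q] that contains [X t] lies in the ball of radius [r]
     around [X t]. *)
  have [q] := rat_in_itvoo (divr_gt0 r0 (ltr0n R 2)).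
  rewrite in_itv/= => /andP[q0 qr].
  have hp j : exists p : rat, `|ratr p - X t 0 j| < ratr q.
    have [p] := @rat_in_itvoo R (X t 0 j - ratr q) (X t 0 j + ratr q) ltac:(lra).
    by rewrite in_itv/= => pI; exists p; rewrite ltr_distl.
  have [p pP] := choice hp.
  have inb : ball (c (\row_j p j, q)) (ratr q) (X t).
    by split => // i j; rewrite !mxE (ord1 i); exact: pP.
  exists (\row_j p j, q) => //; rewrite /F asboolT// => y yb; apply: rA.
  have := ball_triangle (ball_sym inb) yb; apply: le_ball; lra.
apply: countable_bigcupT_measurable => [|p]; first exact: countableP.
rewrite /F; case: ifP => // _.
(* A ball of nonpositive radius is empty: membership includes the positivity of the radius. *)
have [q0|q0] := ltP 0 (ratr p.2 : R); last first.
  rewrite (_ : _ @^-1` _ = set0)//; apply/seteqP; split => // t [].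
  by rewrite ltNge q0.
have -> : X @^-1` ball (c p) (ratr p.2) =
    \bigcap_(j in [set: 'I_k]) (fun t => X t 0 j) @^-1` ball (c p 0 j) (ratr p.2).
  apply/seteqP; split => t; first by move=> [_ h] j _; exact: h.
  by move=> h; split => // i j; rewrite (ord1 i); exact: h.
apply: fin_bigcap_measurable => [|j _]; first exact: finite_finset.
by rewrite -[X in measurable X]setTI; apply: mX => //; exact: measurable_ball.
Qed.

Section Independence.
Context {R : realType} d d' (T : measurableType d) (T' : measurableType d')
  (P : probability T R) (I : finType) (X : I -> T -> T').

(** A pi-system that generates the sigma-algebra of all [X j] with [j != i]. *)
Definition other_events (i : I) : set (set T) :=
  [set E | exists (J : {set I}) (B : I -> set T'),
     [/\ i \notin J, forall j, measurable (B j)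
       & E = \bigcap_(j in [set` J]) X j @^-1` B j]].

Lemma other_events_preimage i j (B : set T') : j != i -> measurable B ->
  other_events i (X j @^-1` B).
Proof.
move=> ji mB; exists [set j]%SET, (fun=> B); split => //; first by rewrite inE eq_sym.
apply/seteqP; split => t; first by move=> h l /=; rewrite inE => /eqP ->.
by apply; rewrite /= inE.
Qed.

Lemma measurable_other_events i j : j != i ->
  measurable_fun setT (X j : g_sigma_algebraType (other_events i) -> T').
Proof.
move=> ji _ B mB; rewrite setTI.
by apply: sub_sigma_algebra; exact: other_events_preimage.
Qed.

Hypothesis mX : forall i, measurable_fun setT (X i).
Hypothesis iX : mutually_independent P X.

(** Both sides are finite measures in [E]. They agree on the pi-system [other_events], hence on the
    sigma-algebra that it generates. *)
Lemma independent_other_events i (A : set T') (E : set T) : measurable A ->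
  <<s other_events i >> E ->
  P (X i @^-1` A `&` E) = (P (X i @^-1` A) * P E)%E.
Proof.
move=> mA.
have mXA j B : measurable B -> measurable (X j @^-1` B).
  by move=> mB; rewrite -[X in measurable X]setTI; exact: mX.
have pf : P (X i @^-1` A) = (fine (P (X i @^-1` A)))%:E.
  by rewrite fineK// fin_num_measure//; exact: mXA.
have p0 : 0 <= fine (P (X i @^-1` A)) by rewrite fine_ge0.
pose m1 := mrestr P (mXA i A mA).
pose m2 := mscale (NngNum p0) P.
rewrite pf setIC; apply: (@g_sigma_algebra_measure_unique _ R T (other_events i)
  _ (fun=> setT) _ _ m1 m2).
- move=> F [J [B [_ mB ->]]]; apply: fin_bigcap_measurable => [|j _].
    exact: finite_finset.
  exact: (mXA j (B j)).
(* The whole space is the intersection over the empty index set. *)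
- move=> _; exists finset.set0, (fun=> setT); split => //; first by rewrite inE.
  by apply/seteqP; split => // t _ j; rewrite /= inE.
- by rewrite bigcup_const//; exists 0%N.
- move=> F G [J [B [iJ mB ->]]] [J' [B' [iJ' mB' ->]]].
  exists (J :|: J')%SET, (fun j => (if j \in J then B j else setT) `&`
     (if j \in J' then B' j else setT)); split.
  + by rewrite inE negb_or iJ.
  + by move=> j; apply: measurableI; case: ifP.
  + apply/seteqP; split => t.
      move=> [h h'] j _; split => /=; case: ifP => // jJ; [exact: h|exact: h'].
    move=> h; split => j /= jJ; have := h j; rewrite /= inE jJ ?orbT => /(_ isT)[].
      by [].
    by [].
(* Agreement on the pi-system is mutual independence for the index set [i |: J], with [A] as the
   event of index [i]. *)
- move=> F [J [B [iJ mB ->]]].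
  pose B' j := if j == i then A else B j.
  have mB' j : measurable (B' j) by rewrite /B'; case: ifP.
  have B'i : B' i = A by rewrite /B' eqxx.
  have := iX (i |: J)%SET mB'; rewrite big_setU1//= B'i.
  have -> : \bigcap_(j in [set` (i |: J)%SET]) X j @^-1` B' j =
      (\bigcap_(j in [set` J]) X j @^-1` B j) `&` X i @^-1` A.
    apply/seteqP; split => t.
      move=> h; split; last by have := h i; rewrite /= !inE eqxx /B' eqxx; apply.
      move=> j /= jJ; have := h j; rewrite /= !inE jJ orbT /B' => /(_ isT).
      by case: eqP => // ji; rewrite -ji jJ in iJ.
    move=> [h hA] j; rewrite /= !inE /B' => /orP[/eqP ->|jJ]; first by rewrite eqxx.
    by case: eqP => [->//|_]; exact: h.
  move=> E1.
  transitivity (P (X i @^-1` A) * P (\bigcap_(j in [set` J]) X j @^-1` B j))%E.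
    rewrite [LHS]E1; congr (_ * _)%E; rewrite (iX J mB); apply: eq_bigr => j jJ.
    by rewrite /B'; case: eqP => // ji; rewrite -ji jJ in iJ.
  by rewrite [X in (X * _)%E]pf.
- move=> _; rewrite /m1/= /mrestr setTI.
  by rewrite (le_lt_trans (probability_le1 _ (mXA i A mA))) ?ltry.
Qed.

End Independence.

(** The joint law is the product of the marginals, since the two agree on rectangles; then Fubini.
    Integrability of every section keeps the inner integral real for every value of [V]. *)
Lemma Rintegral_indep (R : realType) d d1 d2 (T : measurableType d)
    (T1 : measurableType d1) (T2 : measurableType d2) (P : probability T R)
    (X : T -> T1) (V : T -> T2) (F : T2 * T1 -> R) :
  measurable_fun setT X -> measurable_fun setT V -> measurable_fun setT F ->
  (forall A B, measurable A -> measurable B ->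
    P (X @^-1` A `&` V @^-1` B) = (P (X @^-1` A) * P (V @^-1` B))%E) ->
  P.-integrable setT (fun t => (F (V t, X t))%:E) ->
  (forall v, P.-integrable setT (fun t => (F (v, X t))%:E)) ->
  \int[P]_t F (V t, X t) = \int[P]_s (\int[P]_t F (V s, X t)).
Proof.
move=> mX mV mF iXV iF iFv.
pose mfX : {mfun T >-> T1} := HB.pack X (isMeasurableFun.Build _ _ _ _ X mX).
pose mfV : {mfun T >-> T2} := HB.pack V (isMeasurableFun.Build _ _ _ _ V mV).
have mVX : measurable_fun setT (fun t => (V t, X t)) by exact: measurable_fun_pair.
pose VX : {mfun T >-> (T2 * T1)%type} :=
  HB.pack (fun t => (V t, X t)) (isMeasurableFun.Build _ _ _ _ _ mVX).
have mEF : measurable_fun setT (EFin \o F) by exact/measurable_EFinP.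
have prodE A : measurable A ->
    (distribution P mfV \x distribution P mfX)%E A = distribution P VX A.
  move=> mA; apply: product_measure_unique => // B C mB mC.
  transitivity (P (X @^-1` C `&` V @^-1` B)); first by rewrite setIC.
  by rewrite iXV// muleC.
have eqM (f : T2 * T1 -> \bar R) :
    (\int[distribution P mfV \x distribution P mfX]_z f z
     = \int[distribution P VX]_z f z)%E.
  by apply: eq_measure_integral => A mA _; exact: prodE.
have iVX : (distribution P mfV \x distribution P mfX)%E.-integrable setT
    (EFin \o F).
  apply/integrableP; split => //; rewrite eqM.
  have := @integrable_pushforward _ _ _ _ _ VX mVX P setT _ mEF iF measurableT.
  by case/integrableP.
have G1 v : (fubini_F (distribution P mfX) (EFin \o F) v
    = \int[P]_t (F (v, X t))%:E)%E.
  rewrite /fubini_F integral_distribution//; last exact: iFv.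
  exact: (measurable_fun_pair2 v mEF).
have mG : measurable_fun setT (fubini_F (distribution P mfX) (EFin \o F)).
  exact: (measurable_fubini_F iVX).
rewrite /Rintegral; congr fine.
transitivity (\int[distribution P VX]_z (EFin \o F) z)%E.
  by rewrite integral_distribution.
rewrite -eqM -integral12_prod_meas1// integral_distribution//.
  by apply: eq_integral => s _ /=; rewrite G1 fineK//; exact: integrable_fin_num.
apply/integrableP; split; first exact: measurableT_comp.
have /integrableP[_] := integrable_fubini_F iVX.
rewrite ge0_integral_distribution//; exact: measurableT_comp.
Qed.

(** * One-dimensional Gaussian integration by parts *)

Section Density.
Context d (T : measurableType d) (R : realType) (nu : {finite_measure set T -> \bar R})
  (mu : {sigma_finite_measure set T -> \bar R}) (p : T -> R).
Hypothesis p0 : forall x, 0 <= p x.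
Hypothesis ip : mu.-integrable setT (EFin \o p).
Hypothesis nuE : forall A, measurable A -> nu A = (\int[mu]_(x in A) (p x)%:E)%E.

(** The density [p] equals the Radon-Nikodym derivative of [nu] almost everywhere, because both
    integrate to [nu A] over every measurable [A]; the change of variables for that derivative then
    applies. *)
Lemma ge0_integral_density (f : T -> \bar R) : measurable_fun setT f ->
  (forall x, 0 <= f x)%E ->
  (\int[nu]_x f x = \int[mu]_x (f x * (p x)%:E))%E.
Proof.
move=> mf f0.
have dom : nu `<< mu.
  apply/null_content_dominatesP => A mA A0; rewrite nuE//.
  by apply: null_set_integral => //; exact: measurable_funTS (measurable_int _ ip).
have mp := measurable_int _ ip.
rewrite -(Radon_Nikodym_SigmaFinite.change_of_variables dom)//.
have idom := Radon_Nikodym_SigmaFinite.f_integrable dom.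
apply: ge0_ae_eq_integral => //.
- by apply: emeasurable_funM => //; exact: measurable_int idom.
- exact: emeasurable_funM.
- by move=> x _; rewrite mule_ge0//; exact: Radon_Nikodym_SigmaFinite.f_ge0.
- by move=> x _; rewrite mule_ge0// lee_fin.
- apply: ae_eqe_mul2l; apply: integral_ae_eq => // A _ mA.
  by rewrite -Radon_Nikodym_SigmaFinite.f_integral// nuE.
Qed.

Lemma integrable_density (f : T -> R) : measurable_fun setT f ->
  mu.-integrable setT (fun x => (f x * p x)%:E) ->
  nu.-integrable setT (EFin \o f).
Proof.
move=> mf /integrableP[_ ifp]; apply/integrableP.
have mEf : measurable_fun setT (EFin \o f) by exact/measurable_EFinP.
split => //; rewrite ge0_integral_density//; last exact: measurableT_comp.
apply: le_lt_trans ifp; rewrite le_eqVlt; apply/orP; left; apply/eqP.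
by apply: eq_integral => x _; rewrite /= normrM (ger0_norm (p0 x)).
Qed.

Lemma Rintegral_density (f : T -> R) : measurable_fun setT f ->
  mu.-integrable setT (fun x => (f x * p x)%:E) ->
  \int[nu]_x f x = \int[mu]_x (f x * p x).
Proof.
move=> mf ifp; congr fine.
have mEf : measurable_fun setT (EFin \o f) by exact/measurable_EFinP.
rewrite integralE [RHS]integralE.
rewrite !ge0_integral_density//; [|exact: measurable_funeneg|exact: measurable_funepos].
(* As [p >= 0], the positive and negative parts of [f * p] are those of [f] times [p]. *)
congr (_ - _)%E; apply: eq_integral => x _; rewrite !(funeposE, funenegE)/=.
  by rewrite -!EFin_max -EFinM maxr_pMl// mul0r.
by rewrite -!EFin_max -EFinM maxr_pMl// mul0r mulNr.
Qed.

End Density.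

Section WholeLine.
Context {R : realType}.
Notation mu := (@lebesgue_measure R).

(** The truncated integrals are increments of [F] between integers, which tend to 0; by dominated
    convergence they also tend to the full integral. *)
Lemma integral_derivative_eq0 (F F' : R -> R) (C : R) :
  (forall x : R, is_derive x (1 : R) F (F' x)) -> continuous F' ->
  mu.-integrable setT (EFin \o F') ->
  (forall n : nat, `|F n%:R| <= C / n.+1%:R) ->
  (forall n : nat, `|F (- n%:R)| <= C / n.+1%:R) ->
  \int[mu]_x F' x = 0.
Proof.
move=> dF cF' iF' Fp Fn.
(* The fundamental theorem of calculus wants an interval of positive length, hence [n.+1]. *)
pose f_ (n : nat) := (EFin \o F') \_ `[- n.+1%:R, n.+1%:R].
have mF' := measurable_int _ iF'.
have h : (\int[mu]_x f_ n x @[n --> \oo] --> \int[mu]_x (F' x)%:E)%E.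
  apply: (@dominated_cvg _ _ _ mu setT measurableT f_ _
    (fun x => `|(F' x)%:E|%E)) => //.
  - move=> n; apply/(measurable_restrictT _ _).1 => //.
    exact: measurable_funTS.
  - move=> x _; apply: cvg_near_cst; near=> n; rewrite /f_ patchE mem_set//=.
    rewrite in_itv/= -ler_norml.
    have h : `|x| <= n%:R by near: n; exact: nbhs_infty_ger.
    by apply: (le_trans h); rewrite ler_nat.
  - exact: integrable_abse.
  - by move=> n x _; rewrite /f_ patchE; case: ifP => // _; rewrite abse0.
have fE n : (\int[mu]_x f_ n x = (F n.+1%:R - F (- n.+1%:R))%:E)%E.
  rewrite /f_ -integral_mkcond (@continuous_FTC2 _ F' F)//.
  - rewrite -subr_gt0 opprK; exact: addr_gt0.
  - exact: continuous_subspaceT.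
  - have cF : continuous F.
      by move=> x; apply/differentiable_continuous/derivable1_diffP; exact: ex_derive.
    split => [x _||]; first exact: ex_derive.
    + exact/cvg_at_right_filter/cF.
    + exact/cvg_at_left_filter/cF.
  - by move=> x _; rewrite derive1E; exact: derive_val.
have h0 : ((F n.+1%:R - F (- n.+1%:R))%:E @[n --> \oo] --> 0%E)%E.
  apply: cvg_EFin; first exact: nearW.
  apply/cvgr0Pnorm_le => e e0; near=> n.
  apply: (le_trans (ler_normB _ _)); apply: (le_trans (lerD (Fp _) (Fn _))).
  rewrite -mulrDl ler_pdivrMr//.
  have : (C + C) / e <= n%:R by near: n; exact: nbhs_infty_ger.
  rewrite ler_pdivrMr// => /le_trans; apply; rewrite mulrC ler_pM2l// ler_nat.
  exact: leqW.
have -> : 0 = fine (0%E : \bar R) by [].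
congr fine; move: h; rewrite (funext fE) => h.
exact: (cvg_unique _ h h0).
Unshelve. all: by end_near.
Qed.

End WholeLine.

Section Gaussian.
Context {R : realType}.
Notation mu := (@lebesgue_measure R).
Notation N01 := (@normal_prob R 0 1).
Notation phi := (@normal_pdf R 0 1).

Lemma normal_pdf01E x : phi x = normal_peak 1 * expR (- (x ^+ 2 / 2)).
Proof.
rewrite normal_pdfE ?oner_eq0//= /normal_fun subr0 expr1n mulNr.
by rewrite -[1 *+ 2]/(2%:R).
Qed.

Lemma is_derive_normal_pdf01 (x : R) : is_derive x (1 : R) phi (- x * phi x).
Proof.
rewrite (_ : phi = (fun x => normal_peak 1 * expR (- (x ^+ 2 / 2)))); last first.
  by apply/funext => y; exact: normal_pdf01E.
have dq : is_derive x (1 : R) (fun y : R => - (y ^+ 2 / 2)) (- x).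
  apply: is_derive_eq; rewrite /GRing.scale/=; lra.
apply: is_derive_eq; rewrite /GRing.scale/=; ring.
Qed.

(** Domination by the normal density of standard deviation 2: [1 + x ^ 2 <= 4 exp (3 x ^ 2 / 8)],
    where [3 / 8 = 1 / 2 - 1 / 8]. The constant [C] also exchanges the two normalizing factors. *)
Lemma integrable_sqr_normal_pdf01 :
  mu.-integrable setT (fun x => ((1 + x ^+ 2) * phi x)%:E).
Proof.
have p0 : 0 < normal_peak (2 : R) by apply: normal_peak_gt0; rewrite pnatr_eq0.
pose C := 4 * normal_peak (1 : R) / normal_peak 2.
have ig := integrableZl measurableT C (@integrable_normal_pdf R 0 2).
apply: (le_integrable measurableT _ _ ig).
- apply/measurable_EFinP; apply: measurable_funM; last exact: measurable_normal_pdf.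
  by apply: measurable_funD => //; exact: measurable_funX.
- move=> x _; rewrite -EFinM /= lee_fin normal_pdf01E normal_pdfE ?pnatr_eq0//.
  rewrite /normal_fun subr0 ger0_norm; last first.
    by rewrite !mulr_ge0 ?addr_ge0 ?sqr_ge0 ?normal_peak_ge0 ?expR_ge0.
  apply: (le_trans _ (ler_norm _)).
  have -> : C * (normal_peak 2 * expR (- x ^+ 2 / (2 ^+ 2 *+ 2))) =
      normal_peak 1 * (4 * expR (x ^+ 2 * (3 / 8)) * expR (- (x ^+ 2 / 2))).
    rewrite -[4 * _ * _]mulrA -expRD /C.
    have -> : x ^+ 2 * (3 / 8) + - (x ^+ 2 / 2) = - x ^+ 2 / (2 ^+ 2 *+ 2).
      by rewrite -mulr_natr; field.
    by field; exact: lt0r_neq0.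
  rewrite mulrCA ler_wpM2l ?normal_peak_ge0// ler_wpM2r ?expR_ge0//.
  have := expR_ge1Dx (x ^+ 2 * (3 / 8)); have := sqr_ge0 x; lra.
Qed.

Lemma integrable_mul_normal_pdf01 (f : R -> R) C : measurable_fun setT f ->
  (forall x, `|f x| <= C * (1 + x ^+ 2)) ->
  mu.-integrable setT (fun x => (f x * phi x)%:E).
Proof.
move=> mf fC; have ig := integrableZl measurableT C integrable_sqr_normal_pdf01.
apply: (le_integrable measurableT _ _ ig).
  apply/measurable_EFinP; apply: measurable_funM => //.
  exact: measurable_normal_pdf.
move=> x _; rewrite -EFinM/= lee_fin !normrM (ger0_norm (normal_pdf_ge0 _ _ _)).
rewrite mulrA ler_wpM2r ?normal_pdf_ge0// -normrM.
exact: (le_trans (fC x) (ler_norm _)).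
Qed.

Lemma integrable_normal_prob01 (f : R -> R) C : measurable_fun setT f ->
  (forall x, `|f x| <= C * (1 + x ^+ 2)) -> N01.-integrable setT (EFin \o f).
Proof.
move=> mf fC; apply: (@integrable_density _ _ _ _ mu phi) => //.
- by move=> x; exact: normal_pdf_ge0.
- exact: integrable_normal_pdf.
- exact: integrable_mul_normal_pdf01 fC.
Qed.

(** From [(1 + |x|) ^ 2 <= 4 (1 + x ^ 2 / 2) <= 4 exp (x ^ 2 / 2)]. One power of [1 + |x|] will
    absorb the linear growth of a test function, and the other is the decay at infinity. *)
Lemma normal_pdf01_le (x : R) : phi x <= 4 * normal_peak 1 / (1 + `|x|) ^+ 2.
Proof.
rewrite ler_pdivlMr ?exprn_gt0 ?ltr_wpDr// normal_pdf01E (mulrC 4) -mulrA.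
rewrite ler_wpM2l ?normal_peak_ge0// mulrC expRN ler_pdivrMr ?expR_gt0//.
have := expR_ge1Dx (x ^+ 2 / 2); rewrite -(real_normK (num_real x)).
by have := sqr_ge0 (`|x| - 1); nra.
Qed.

(* The increment of [f * phi] over the line vanishes, and its derivative is
   [(f' - x * f) * phi]. *)
Lemma normal_integration_by_parts (f f' : R -> R) A B :
  (forall x : R, is_derive x (1 : R) f (f' x)) -> continuous f' ->
  (forall x, `|f x| <= A * (1 + `|x|)) -> (forall x, `|f' x| <= B) ->
  \int[N01]_x (x * f x) = \int[N01]_x f' x.
Proof.
move=> df cf' fA f'B.
have A0 : 0 <= A by have := le_trans (normr_ge0 _) (fA 0); rewrite normr0 addr0 mulr1.
have B0 : 0 <= B := le_trans (normr_ge0 _) (f'B 0).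
have mf' : measurable_fun setT f' by exact: continuous_measurable_fun.
have cf : continuous f.
  by move=> x; apply/differentiable_continuous/derivable1_diffP; exact: ex_derive.
have mf : measurable_fun setT f by exact: continuous_measurable_fun.
have mxf : measurable_fun setT (fun x : R => x * f x) by exact: measurable_funM.
have cphi : continuous phi by apply: continuous_normal_pdf; rewrite oner_eq0.
have xfb x : `|x * f x| <= 2 * A * (1 + x ^+ 2).
  rewrite normrM (mulrC 2) -mulrA.
  apply: (@le_trans _ _ (A * (`|x| * (1 + `|x|)))); first by rewrite mulrCA ler_wpM2l.
  rewrite ler_wpM2l// -(real_normK (num_real x)).
  by have := sqr_ge0 (`|x| - 1); have := normr_ge0 x; nra.
have f'b x : `|f' x| <= B * (1 + x ^+ 2).
  by apply: (le_trans (f'B x)); rewrite ler_peMr// lerDl sqr_ge0.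
have mh : measurable_fun setT (fun x : R => f' x - x * f x) by exact: measurable_funB.
have ih : mu.-integrable setT (fun x => ((f' x - x * f x) * phi x)%:E).
  apply: (@integrable_mul_normal_pdf01 _ (B + 2 * A)) => // x.
  by rewrite mulrDl (le_trans (ler_normB _ _))// lerD.
apply/eqP; rewrite eq_sym -subr_eq0 -RintegralB//; last 2 first.
- exact: integrable_normal_prob01 f'b.
- exact: integrable_normal_prob01 xfb.
apply/eqP; rewrite (@Rintegral_density _ _ _ N01 mu phi)//; last 2 first.
- by move=> x; exact: normal_pdf_ge0.
- exact: integrable_normal_pdf.
have Fb x : `|f x * phi x| <= 4 * normal_peak 1 * A / (1 + `|x|).
  rewrite normrM (ger0_norm (normal_pdf_ge0 _ _ _)).
  apply: (le_trans (ler_pM _ _ (fA x) (normal_pdf01_le x))) => //.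
    exact: normal_pdf_ge0.
  rewrite expr2 le_eqVlt; apply/orP; left; apply/eqP; field.
  by rewrite gt_eqF// ltr_wpDr.
apply: (@integral_derivative_eq0 _ (fun x => f x * phi x) _ (4 * normal_peak 1 * A)).
- move=> x; have dp := is_derive_normal_pdf01 x.
  apply: is_derive_eq; rewrite /GRing.scale/=; ring.
- move=> x; apply: cvgM; last exact: cphi.
  by apply: cvgB; [exact: cf'|apply: cvgM; [exact: cvg_id|exact: cf]].
- exact: ih.
- by move=> n; rewrite (le_trans (Fb _))// ger0_norm// nat1r.
- by move=> n; rewrite (le_trans (Fb _))// normrN ger0_norm// nat1r.
Qed.

End Gaussian.

(** * Real-valued integrals over a probability space *)

Section Rint.
Context d (T : measurableType d) (R : realType) (P : probability T R).
Implicit Types (f h : T -> R).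
Notation Int f := (P.-integrable setT (EFin \o f)).

Lemma Rintegrable_dominated f h : measurable_fun setT f ->
  (forall t, `|f t| <= h t) -> Int h -> Int f.
Proof.
move=> mf fh ih; apply: (le_integrable measurableT _ _ ih).
  exact/measurable_EFinP.
by move=> t _; rewrite /= lee_fin (le_trans (fh t))// ler_norm.
Qed.

Lemma Rintegrable_measurable f : Int f -> measurable_fun setT f.
Proof. by move=> /measurable_int/measurable_EFinP. Qed.

Lemma Rintegrable_cst (r : R) : Int (fun=> r).
Proof. exact: finite_measure_integrable_cst. Qed.

Lemma Rintegrable_bounded f (C : R) : measurable_fun setT f ->
  (forall t, `|f t| <= C) -> Int f.
Proof.
by move=> mf fC; apply: Rintegrable_dominated fC _ => //; exact: Rintegrable_cst.
Qed.

Lemma RintegrableD f h : Int f -> Int h -> Int (fun t => f t + h t).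
Proof. by move=> fi hi; exact: (integrableD measurableT fi hi). Qed.

Lemma RintegrableB f h : Int f -> Int h -> Int (fun t => f t - h t).
Proof. by move=> fi hi; exact: (integrableB measurableT fi hi). Qed.

Lemma RintegrableZ (r : R) f : Int f -> Int (fun t => r * f t).
Proof. by move=> fi; exact: (integrableZl measurableT r fi). Qed.

Lemma Rintegrable_norm f : Int f -> Int (fun t => `|f t|).
Proof. by move=> fi; exact: (integrable_abse fi). Qed.

Lemma Rintegrable_sum (I : Type) (s : seq I) (F : I -> T -> R) :
  (forall i, Int (F i)) -> Int (fun t => \sum_(i <- s) F i t).
Proof.
move=> Fi; elim: s => [|i s IHs].
  by under eq_fun do rewrite big_nil; exact: Rintegrable_cst.
by under eq_fun do rewrite big_cons; exact: RintegrableD.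
Qed.

Lemma Rintegral_prob_cst (r : R) : \int[P]_t r = r.
Proof. by rewrite Rintegral_cst// [X in fine X]probability_setT mulr1. Qed.

Lemma Rintegral_sum (I : Type) (s : seq I) (F : I -> T -> R) :
  (forall i, Int (F i)) ->
  \int[P]_t (\sum_(i <- s) F i t) = \sum_(i <- s) \int[P]_t F i t.
Proof.
move=> Fi; elim: s => [|i s IHs].
  under eq_Rintegral do rewrite big_nil.
  by rewrite Rintegral_prob_cst big_nil.
under eq_Rintegral do rewrite big_cons.
by rewrite RintegralD// ?IHs ?big_cons//; exact: Rintegrable_sum.
Qed.

Lemma normr_Rintegral_le f h : measurable_fun setT f -> Int h ->
  (forall t, `|f t| <= h t) -> `|\int[P]_t f t| <= \int[P]_t h t.
Proof.
move=> mf hi fh; have fi := Rintegrable_dominated mf fh hi.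
apply: (le_trans (le_normr_Rintegral _ _)) => //.
by apply: le_Rintegral => //; exact: Rintegrable_norm.
Qed.

(** The variance of [|f|] is nonnegative; integrability of [f] comes from [|f| <= 1 + f ^ 2]. *)
Lemma Rintegral_norm_le_sqrt f : measurable_fun setT f ->
  Int (fun t => f t ^+ 2) ->
  Int f /\ \int[P]_t `|f t| <= Num.sqrt (\int[P]_t f t ^+ 2).
Proof.
move=> mf f2i.
have fi : Int f.
  apply: (Rintegrable_dominated (h := fun t => 1 + f t ^+ 2)) => // [t|].
    by rewrite -(real_normK (num_real (f t))); have := sqr_ge0 (`|f t| - 1); nra.
  exact: RintegrableD (Rintegrable_cst 1) f2i.
split=> //; set m := \int[P]_t `|f t|.
have m0 : 0 <= m by exact: Rintegral_ge0.
have nfi := Rintegrable_norm fi.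
rewrite -[leLHS]ger0_norm// -sqrtr_sqr ler_wsqrtr// -subr_ge0.
have -> : \int[P]_t f t ^+ 2 - m ^+ 2 =
    \int[P]_t ((f t ^+ 2 - 2 * m * `|f t|) + m ^+ 2).
  rewrite RintegralD//; last 2 first.
  - exact: RintegrableB f2i (RintegrableZ _ nfi).
  - exact: Rintegrable_cst.
  rewrite RintegralB//; last exact: (RintegrableZ _ nfi).
  by rewrite RintegralZl// Rintegral_prob_cst -/m; ring.
apply: Rintegral_ge0 => t _; rewrite -(real_normK (num_real (f t))).
by have := sqr_ge0 (`|f t| - m); nra.
Qed.

End Rint.

(** * Gaussian vectors *)

Section IndepRest.
Context {R : realType} d d' d2 (T : measurableType d) (T' : measurableType d')
  (T2 : measurableType d2) (P : probability T R) (I : finType) (X : I -> T -> T').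
Hypothesis mX : forall i, measurable_fun setT (X i).
Hypothesis iX : mutually_independent P X.

Lemma other_events_measurable i : <<s other_events X i >> `<=` measurable.
Proof.
apply: smallest_sub; first exact: sigma_algebra_measurable.
move=> F [J [B [_ mB ->]]]; apply: fin_bigcap_measurable => [|j _].
  exact: finite_finset.
by rewrite -[X in measurable X]setTI; exact: mX.
Qed.

Lemma measurable_of_others i (V : T -> T2) :
  measurable_fun setT (V : g_sigma_algebraType (other_events X i) -> T2) ->
  measurable_fun setT V.
Proof.
move=> mV _ B mB; rewrite setTI; apply: (@other_events_measurable i).
by rewrite -[_ @^-1` _]setTI; exact: mV.
Qed.

(** The form in which independence is used from here on: any [V] built from the other variables is
    frozen while [X i] is averaged. *)
Lemma Rintegral_indep_others i (V : T -> T2) (F : T2 * T' -> R) :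
  measurable_fun setT (V : g_sigma_algebraType (other_events X i) -> T2) ->
  measurable_fun setT F ->
  P.-integrable setT (fun t => (F (V t, X i t))%:E) ->
  (forall v, P.-integrable setT (fun t => (F (v, X i t))%:E)) ->
  \int[P]_t F (V t, X i t) = \int[P]_s (\int[P]_t F (V s, X i t)).
Proof.
move=> mV mF iF iFv; apply: Rintegral_indep => //.
  exact: measurable_of_others mV.
move=> A B mA mB; apply: (independent_other_events mX iX mA).
by rewrite -[_ @^-1` _]setTI; exact: mV.
Qed.

End IndepRest.

Section GaussianVector.
Context {R : realType} {k : nat} d (T : measurableType d) (P : probability T R)
  (Z : T -> 'rV[R]_k).
Hypothesis mZ : measurable_fun setT Z.
Hypothesis gZ : standard_gaussian P Z.
Notation N01 := (@normal_prob R 0 1).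
Notation Int f := (P.-integrable setT (EFin \o f)).

Let mZj j : measurable_fun setT (fun t => Z t 0 j) := measurable_coord j mZ.

Lemma gaussian_coord j (f : R -> R) : measurable_fun setT f ->
  N01.-integrable setT (EFin \o f) ->
  Int (fun t => f (Z t 0 j)) /\ \int[P]_t f (Z t 0 j) = \int[N01]_x f x.
Proof.
move=> mf fi.
have mEf : measurable_fun setT (EFin \o f) by exact/measurable_EFinP.
pose X : {mfun T >-> measurableTypeR R} :=
  HB.pack (fun t => Z t 0 j) (isMeasurableFun.Build _ _ T (measurableTypeR R) _ (mZj j)).
have EN h : (\int[N01]_x h x = \int[distribution P X]_x h x)%E.
  apply: eq_measure_integral => A mA _.
  by rewrite /= -(gZ.2 j A mA).
have ifZ : Int (fun t => f (Z t 0 j)).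
  apply/integrableP; split; first exact: (measurableT_comp mEf (mZj j)).
  have /integrableP[_] := fi.
  rewrite EN ge0_integral_distribution//; exact: measurableT_comp.
split => //; congr fine; rewrite EN integral_distribution//.
Qed.

(** Integration by parts against the constant 1; against the identity it gives the second moment
    below. *)
Lemma gaussian_coord_mean j : Int (fun t => Z t 0 j) /\ \int[P]_t Z t 0 j = 0.
Proof.
have idi : N01.-integrable setT (EFin \o (fun x : R => x)).
  apply: (@integrable_normal_prob01 _ _ 1) => // x.
  by rewrite mul1r -(real_normK (num_real x)); have := sqr_ge0 (`|x| - 1); nra.
have [? ->] := gaussian_coord j (@measurable_id _ _ setT) idi.
split=> //.
have := @normal_integration_by_parts R (fun=> 1) (fun=> 0) 1 0
  (fun x => is_derive_cst _ _ _).
under eq_Rintegral do rewrite mulr1.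
move=> ->; first by rewrite Rintegral_prob_cst.
- by move=> x; exact: cvg_cst.
- by move=> x; rewrite normr1 mul1r lerDl.
- by move=> x; rewrite normr0.
Qed.

Lemma gaussian_coord_sqr j :
  Int (fun t => Z t 0 j ^+ 2) /\ \int[P]_t Z t 0 j ^+ 2 = 1.
Proof.
have sqi : N01.-integrable setT (EFin \o (fun x : R => x ^+ 2)).
  apply: (@integrable_normal_prob01 _ _ 1); first exact: measurable_funX.
  by move=> x; rewrite mul1r ger0_norm ?sqr_ge0// lerDr.
have [|? ->] := gaussian_coord j _ sqi; first exact: measurable_funX.
split=> //.
have := @normal_integration_by_parts R (fun x => x) (fun=> 1) 1 1
  (fun x => is_derive_id _ _).
under eq_Rintegral do rewrite -expr2.
move=> ->; first by rewrite Rintegral_prob_cst.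
- by move=> x; exact: cvg_cst.
- by move=> x; rewrite mul1r lerDr.
- by move=> x; rewrite normr1.
Qed.

Lemma gaussian_coordM i j :
  Int (fun t => Z t 0 i * Z t 0 j) /\ \int[P]_t (Z t 0 i * Z t 0 j) = (i == j)%:R.
Proof.
have [i2 _] := gaussian_coord_sqr i; have [j2 E2] := gaussian_coord_sqr j.
have iij : Int (fun t => Z t 0 i * Z t 0 j).
  apply: (Rintegrable_dominated (h := fun t => Z t 0 i ^+ 2 + Z t 0 j ^+ 2)).
  - exact: measurable_funM.
  - move=> t; rewrite ler_norml.
    have := sqr_ge0 (Z t 0 i - Z t 0 j); have := sqr_ge0 (Z t 0 i + Z t 0 j).
    by have := sqr_ge0 (Z t 0 i); have := sqr_ge0 (Z t 0 j); nra.
  - exact: RintegrableD i2 j2.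
split=> //; have [->|ij] := eqVneq i j.
  by under eq_Rintegral do rewrite -expr2.
have [i1 Ei] := gaussian_coord_mean i.
rewrite (@Rintegral_indep_others _ _ _ _ T _ R P _ _ mZj gZ.1 i
  (fun t => Z t 0 j) (fun vx => vx.2 * vx.1)).
- under eq_Rintegral do rewrite RintegralZr// Ei mul0r.
  by rewrite Rintegral_prob_cst.
- by apply: (measurable_other_events (X := fun j t => Z t 0 j)); rewrite eq_sym.
- by apply: measurable_funM; [exact: measurable_snd|exact: measurable_fst].
- exact: iij.
- move=> v; under eq_fun do rewrite /= mulrC; exact: (RintegrableZ v i1).
Qed.

Section Stein.
Variables (g : 'rV[R]_k -> R) (B L : R).
Hypothesis dg : forall x, differentiable g x.
Hypothesis gB : forall x, `|g x| <= B.
Hypothesis GL : forall x, enorm (gradient g x) <= L.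
Hypothesis cG : forall j, continuous (fun x => gradient g x 0 j).

Let mg : measurable_fun setT g.
Proof.
by apply: continuous_measurable_matrix => x; exact: differentiable_continuous.
Qed.

Let mG j : measurable_fun setT (fun x => gradient g x 0 j).
Proof. exact: continuous_measurable_matrix. Qed.

Let L0 : 0 <= L := le_trans (enorm_ge0 _) (GL 0).

Lemma measurable_affine (a : 'rV[R]_k) (c : R) :
  measurable_fun setT (fun t => a + c *: Z t).
Proof.
apply: measurable_rV => j; under eq_fun do rewrite !mxE.
by apply: measurable_funD => //; exact: measurable_funM.
Qed.

(** Freeze the coordinates other than [j] and integrate by parts on the line; [c] is the chain-rule
    factor. *)
Lemma gaussian_integration_by_parts j (a : 'rV[R]_k) (c : R) :
  \int[P]_t (Z t 0 j * g (a + c *: Z t)) =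
  c * \int[P]_t gradient g (a + c *: Z t) 0 j.
Proof.
(* [V] is [Z] with coordinate [j] erased, hence a function of the other coordinates; [A] puts the
   coordinate back. *)
pose V t : 'rV[R]_k := \row_l (if l == j then 0 else Z t 0 l).
pose e : 'rV[R]_k := delta_mx 0 j.
have VE t : Z t = V t + Z t 0 j *: e.
  apply/rowP => l; rewrite !mxE eqxx/=.
  by case: eqP => [->|_]; rewrite ?mulr1 ?add0r ?mulr0 ?addr0.
pose A (v : 'rV[R]_k) (x : R) := a + c *: (v + x *: e).
have AE v x : A v x = (a + c *: v) + x *: (c *: e).
  by rewrite /A scalerDr addrA !scalerA mulrC.
have mA : measurable_fun setT (fun vx : 'rV[R]_k * R => A vx.1 vx.2).
  apply: measurable_rV => l; under eq_fun do rewrite !mxE.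
  apply: measurable_funD => //; apply: measurable_funM => //.
  apply: measurable_funD; last first.
    by apply: measurable_funM => //; exact: measurable_snd.
  by apply: measurable_coord; exact: measurable_fst.
have mV : measurable_fun setT
    (V : g_sigma_algebraType (other_events (fun l t => Z t 0 l) j) -> 'rV[R]_k).
  apply: measurable_rV => l.
  rewrite (_ : (fun t => _) = (fun t => if l == j then 0 else Z t 0 l)); last first.
    by apply/funext => t; rewrite mxE.
  have [_|lj] := eqVneq l j; first exact: measurable_cst.
  exact: (measurable_other_events (X := fun j t => Z t 0 j)).
have [i1 Ei] := gaussian_coord_mean j.
have mgA : measurable_fun setT (fun vx : 'rV[R]_k * R => g (A vx.1 vx.2)).
  exact: (measurableT_comp mg).
have mGA : measurable_fun setT (fun vx : 'rV[R]_k * R => gradient g (A vx.1 vx.2) 0 j).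
  exact: (measurableT_comp (mG j)).
have gb f : measurable_fun setT f -> Int (fun t => Z t 0 j * g (f t)).
  move=> mf; apply: (Rintegrable_dominated (h := fun t => B * `|Z t 0 j|)).
  - by apply: measurable_funM => //; exact: measurableT_comp.
  - by move=> t; rewrite normrM mulrC ler_wpM2r.
  - exact: RintegrableZ (Rintegrable_norm i1).
have Gb f : measurable_fun setT f -> Int (fun t => gradient g (f t) 0 j).
  move=> mf; apply: (@Rintegrable_bounded _ _ _ _ _ L).
    exact: (measurableT_comp (mG j)).
  by move=> t; exact: (le_trans (coord_le_enorm _ _) (GL _)).
have mAZ v : measurable_fun setT (fun t => A v (Z t 0 j)).
  exact: (measurableT_comp (measurable_fun_pair2 v mA) (mZj j)).
have IE : Int (fun t => Z t 0 j * g (A (V t) (Z t 0 j))).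
  under eq_fun do rewrite /A -VE; exact: gb (measurable_affine _ _).
have IG : Int (fun t => gradient g (A (V t) (Z t 0 j)) 0 j).
  under eq_fun do rewrite /A -VE; exact: Gb (measurable_affine _ _).
rewrite -RintegralZl//; last exact: Gb (measurable_affine _ _).
transitivity (\int[P]_s \int[P]_t (Z t 0 j * g (A (V s) (Z t 0 j)))).
  transitivity (\int[P]_t (Z t 0 j * g (A (V t) (Z t 0 j)))).
    by apply: eq_Rintegral => t _; rewrite /A -VE.
  apply: (@Rintegral_indep_others _ _ _ _ T _ 'rV[R]_k P _ _ mZj gZ.1 j V
    (fun vx => vx.2 * g (A vx.1 vx.2))) => //.
  - by apply: measurable_funM => //; exact: measurable_snd.
  - by move=> v; exact: (gb _ (mAZ v)).
transitivity (\int[P]_s \int[P]_t (c * gradient g (A (V s) (Z t 0 j)) 0 j)); last first.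
  transitivity (\int[P]_t (c * gradient g (A (V t) (Z t 0 j)) 0 j)); last first.
    by apply: eq_Rintegral => t _; rewrite /A -VE.
  apply/esym; apply: (@Rintegral_indep_others _ _ _ _ T _ 'rV[R]_k P _ _ mZj gZ.1 j V
    (fun vx => c * gradient g (A vx.1 vx.2) 0 j)) => //.
  - exact: measurable_funM.
  - exact: (RintegrableZ c IG).
  - by move=> v; exact: (RintegrableZ c (Gb _ (mAZ v))).
apply: eq_Rintegral => s _; set v := V s.
have dgl x : is_derive x (1 : R) (fun x => g (A v x)) (c * gradient g (A v x) 0 j).
  have := is_derive_line (dg ((a + c *: v) + x *: (c *: e))).
  rewrite dotvZr -AE (_ : dotv _ e = gradient g (A v x) 0 j).
    by congr (is_derive _ _ _ _); apply/funext => y; rewrite AE.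
  rewrite /dotv (bigD1 j)//= [e 0 j]mxE !eqxx mulr1 big1 ?addr0// => l lj.
  by rewrite [e 0 l]mxE (negbTE lj) mulr0.
have cgl : continuous (fun x => c * gradient g (A v x) 0 j).
  move=> x; apply: cvgM; first exact: cvg_cst.
  apply: (cvg_comp (A v) (fun x => gradient g x 0 j)); last exact: cG.
  rewrite (funext (AE v)); apply: cvgD; first exact: cvg_cst.
  exact: scalel_continuous.
have B0 : 0 <= B := le_trans (normr_ge0 _) (gB 0).
have gAb x : `|g (A v x)| <= B * (1 + `|x|).
  by apply: (le_trans (gB _)); rewrite ler_peMr// lerDl.
have GAb x : `|c * gradient g (A v x) 0 j| <= `|c| * L.
  by rewrite normrM ler_wpM2l//; exact: (le_trans (coord_le_enorm _ _) (GL _)).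
have mgl : measurable_fun setT (fun x => g (A v x)) by exact: (measurable_fun_pair2 v mgA).
have mGl : measurable_fun setT (fun x => c * gradient g (A v x) 0 j).
  by apply: measurable_funM => //; exact: (measurable_fun_pair2 v mGA).
have mxg : measurable_fun setT (fun x : R => x * g (A v x)) by exact: measurable_funM.
have [|_ ->] := @gaussian_coord j _ mxg.
  apply: (@integrable_normal_prob01 _ _ B) => // x.
  rewrite normrM mulrC ler_pM// -(real_normK (num_real x)).
  by have := sqr_ge0 (`|x| - 1); nra.
have [|_ ->] := @gaussian_coord j _ mGl.
  apply: (@integrable_normal_prob01 _ _ (`|c| * L)) => // x.
  by apply: (le_trans (GAb x)); rewrite ler_peMr ?mulr_ge0// lerDl sqr_ge0.
exact: normal_integration_by_parts dgl cgl gAb GAb.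
Qed.

End Stein.
End GaussianVector.

(** * Interpolation along a quarter circle *)

Section Trigo.
Context {R : realType}.

Lemma mean_value (f f' : R -> R) (x h : R) :
  (forall y : R, is_derive y (1 : R) f (f' y)) ->
  exists2 y, `|y - x| <= `|h| & f (x + h) - f x = f' y * h.
Proof.
move=> df.
have cf a b : {within `[a, b], continuous f}.
  by apply: derivable_within_continuous => y _; exact: ex_derive.
have [h0|h0] := leP 0 h.
  have [y] := @MVT_segment R f f' x (x + h) (ltac:(lra)) (fun y _ => df y) (cf _ _).
  rewrite in_itv/= => /andP[xy yh] E; exists y; last by rewrite E; congr (_ * _); ring.
  by rewrite (ger0_norm h0) ger0_norm; lra.
have [y] := @MVT_segment R f f' (x + h) x (ltac:(lra)) (fun y _ => df y) (cf _ _).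
rewrite in_itv/= => /andP[xy yh] E; exists y.
  by rewrite (ltr0_norm h0) ler0_norm; lra.
by rewrite -opprB E; ring.
Qed.

Lemma sin_lipschitz (x h : R) : `|sin (x + h) - sin x| <= `|h|.
Proof.
have [y _ ->] := mean_value x h (@is_derive_sin R).
by rewrite normrM ler_piMl// ler_norml cos_geN1 cos_le1.
Qed.

Lemma cos_lipschitz (x h : R) : `|cos (x + h) - cos x| <= `|h|.
Proof.
have [y _ ->] := mean_value x h (@is_derive_cos R).
by rewrite normrM normrN ler_piMl// ler_norml sin_geN1 sin_le1.
Qed.

Lemma sin_taylor (x h : R) : `|sin (x + h) - sin x - h * cos x| <= h ^+ 2.
Proof.
have [y yx ->] := mean_value x h (@is_derive_sin R).
rewrite mulrC -mulrBr normrM -(real_normK (num_real h)) expr2 ler_wpM2l//.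
have := cos_lipschitz x (y - x); rewrite [x + _]addrC subrK => h'.
exact: le_trans yx.
Qed.

Lemma cos_taylor (x h : R) : `|cos (x + h) - cos x + h * sin x| <= h ^+ 2.
Proof.
have [y yx ->] := mean_value x h (@is_derive_cos R).
rewrite mulrC mulrN addrC -mulrBr normrM -(real_normK (num_real h)) expr2 ler_wpM2l//.
have := sin_lipschitz x (y - x); rewrite [x + _]addrC subrK distrC => h'.
exact: le_trans yx.
Qed.

(** A remainder bound [C * h ^ 2] can be integrated over the probability spaces, so this criterion
    replaces differentiation under the integral sign. *)
Lemma is_derive_quadratic_remainder (f : R -> R) (C x l : R) :
  (forall h, `|f (x + h) - f x - h * l| <= C * h ^+ 2) ->
  is_derive x (1 : R) f l.
Proof.
move=> fC.
have C0 : 0 <= C by have := le_trans (normr_ge0 _) (fC 1); rewrite expr1n mulr1.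
have lim : h^-1 *: (f (h *: (1 : R) + x) - f x) @[h --> 0^'] --> l.
  apply/cvgrPdist_le => e e0.
  (* The added 1 covers [C = 0]. *)
  have d0 : 0 < e / (C + 1) by rewrite divr_gt0// ltr_wpDl.
  near=> h.
  have h0 : h != 0 by near: h; exact: nbhs_dnbhs_neq.
  have he : `|h| <= e / (C + 1).
    by near: h; apply: dnbhs0_le.
  rewrite /GRing.scale/= mulr1 (addrC h) distrC.
  have -> : h^-1 * (f (x + h) - f x) - l = h^-1 * (f (x + h) - f x - h * l) by field.
  rewrite normrM normfV ler_pdivrMl ?normr_gt0//.
  apply: (le_trans (fC h)); rewrite -(real_normK (num_real h)) expr2 mulrCA.
  rewrite ler_wpM2l//; move: he; rewrite ler_pdivlMr ?ltr_wpDl//.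
  by have := normr_ge0 h; nra.
apply: DeriveDef; first by apply/cvg_ex; exists l.
exact: cvg_lim.
Unshelve. all: by end_near. Qed.

Lemma sinusoidal_interpolation (f f' : R -> R) (C a b : R) :
  (forall x h, `|f (x + h) - f x - h * f' x| <= C * h ^+ 2) ->
  (forall x, 0 <= sin x -> 0 <= cos x -> `|f' x| <= a * sin x + b * sin x ^+ 2) ->
  `|f (pi / 2) - f 0| <= a + b * pi / 4.
Proof.
move=> fC f'b; have df x := is_derive_quadratic_remainder (fC x).
(* A primitive of [a sin + b sin ^ 2]. Over the quarter period [sin] integrates to 1 and [sin ^ 2]
   to [pi / 4]. *)
pose Bd x : R := b / 2 * (x - sin x * cos x) - a * cos x.
have dB (x : R) : is_derive x (1 : R) Bd (a * sin x + b * sin x ^+ 2).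
  rewrite /Bd; apply: is_derive_eq; rewrite /GRing.scale/=.
  apply/eqP; rewrite -subr_eq0; apply/eqP.
  transitivity (b / 2 * (1 - (cos x ^+ 2 + sin x ^+ 2))); first by field.
  by rewrite cos2Dsin2 subrr mulr0.
have p0 := @pi_gt0 R.
have bd x : 0 <= x <= pi / 2 -> `|f' x| <= a * sin x + b * sin x ^+ 2.
  move=> /andP[x0 xp]; apply: f'b.
    by apply: sin_ge0_pi; rewrite x0/=; lra.
  by apply: cos_ge0_pihalf; rewrite xp andbT; lra.
have BE : Bd (pi / 2) - Bd 0 = a + b * pi / 4.
  by rewrite /Bd sin0 cos0 cos_pihalf; field.
have h2 : 0 <= pi / 2 :> R by rewrite divr_ge0// ltW.
have ub := increment_le h2 df dB (fun x xI => le_trans (ler_norm _) (bd x xI)).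
have ndf x := is_deriveN (df x).
have := increment_le h2 ndf dB
  (fun x xI => le_trans (ler_norm _) (eq_ind_r (fun z => z <= _) (bd x xI) (normrN _))).
rewrite -[(- f) _]/(- f _) -[(- f) 0]/(- f 0) => lb.
rewrite ler_norml; apply/andP; split; lra.
Qed.

End Trigo.

(** * Gaussian smoothing *)

Lemma lipschitz_enorm_continuous (R : realType) (k : nat) (f : 'rV[R]_k -> R) (C : R) :
  (forall x y, `|f x - f y| <= C * enorm (x - y)) -> continuous f.
Proof.
move=> fC x; apply/(@cvgrPdist_le _ _ _ (nbhs x) (nbhs_filter x)) => e e0.
(* The absolute value and the added 1 keep the radius positive for every sign of [C] and for
   [k = 0]. *)
have D0 : 0 < `|C| * k%:R + 1 by rewrite ltr_wpDl// mulr_ge0.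
have d0 : 0 < e / (`|C| * k%:R + 1) by rewrite divr_gt0.
apply/nbhs_ballP; exists (e / (`|C| * k%:R + 1)) => //= y.
rewrite -ball_normE /= => /ltW hy.
apply: (le_trans (fC _ _)); apply: (@le_trans _ _ (`|C| * (k%:R * `|x - y|))).
  apply: (le_trans (ler_wpM2r (enorm_ge0 _) (ler_norm C))).
  by rewrite ler_wpM2l// enorm_le_norm.
move: hy; rewrite ler_pdivlMr//; have := normr_ge0 (x - y); nra.
Qed.

Lemma measurable_enorm (R : realType) (k : nat) : measurable_fun setT (@enorm R k).
Proof.
apply: continuous_measurable_matrix; apply: (@lipschitz_enorm_continuous _ _ _ 1).
move=> x y; rewrite mul1r ler_norml.
have := enorm_triangle (x - y) y; rewrite subrK.
by have := enorm_triangle (y - x) x; rewrite subrK -(enormN (y - x)) opprB; lra.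
Qed.

Section Smoothing.
Context {R : realType} {k : nat} d (T : measurableType d) (P : probability T R)
  (Z : T -> 'rV[R]_k).
Hypothesis mZ : measurable_fun setT Z.
Hypothesis gZ : standard_gaussian P Z.
Notation Int f := (P.-integrable setT (EFin \o f)).

Let mZj j : measurable_fun setT (fun t => Z t 0 j) := measurable_coord j mZ.
Let iZZ i j : Int (fun t => Z t 0 i * Z t 0 j) := (gaussian_coordM mZ gZ i j).1.
Let iZ i : Int (fun t => Z t 0 i) := (gaussian_coord_mean mZ gZ i).1.

(** Since [Z] has identity covariance, the mean square of [|Z M|] is the squared Frobenius norm of
    [M]; the bound on the mean follows by Cauchy-Schwarz. *)
Lemma gaussian_enorm_mulmx l (M : 'M[R]_(k, l)) :
  [/\ Int (fun t => enorm (Z t *m M) ^+ 2),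
      \int[P]_t enorm (Z t *m M) ^+ 2 = \sum_i \sum_j M i j ^+ 2,
      Int (fun t => enorm (Z t *m M))
    & \int[P]_t enorm (Z t *m M) <= Num.sqrt (\sum_i \sum_j M i j ^+ 2)].
Proof.
have E t : enorm (Z t *m M) ^+ 2 =
    \sum_j \sum_i \sum_i' (M i j * M i' j) * (Z t 0 i * Z t 0 i').
  rewrite sqr_enorm; apply: eq_bigr => j _; rewrite !mxE big_distrl/=.
  apply: eq_bigr => i _; rewrite big_distrr/=; apply: eq_bigr => i' _; ring.
have i3 j i i' : Int (fun t => (M i j * M i' j) * (Z t 0 i * Z t 0 i')).
  exact: (RintegrableZ _ (iZZ i i')).
have i2 j i : Int (fun t => \sum_i' (M i j * M i' j) * (Z t 0 i * Z t 0 i')).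
  exact: Rintegrable_sum.
have i1 j : Int (fun t => \sum_i \sum_i' (M i j * M i' j) * (Z t 0 i * Z t 0 i')).
  exact: Rintegrable_sum.
have isq : Int (fun t => enorm (Z t *m M) ^+ 2).
  by rewrite (funext E); exact: Rintegrable_sum.
have Esq : \int[P]_t enorm (Z t *m M) ^+ 2 = \sum_i \sum_j M i j ^+ 2.
  rewrite (funext E) Rintegral_sum// exchange_big/=; apply: eq_bigr => j _.
  rewrite Rintegral_sum//; apply: eq_bigr => i _.
  rewrite Rintegral_sum// (bigD1 i)//= big1 ?addr0 => [|i' i'i].
    by rewrite RintegralZl// (gaussian_coordM mZ gZ i i).2 eqxx mulr1 expr2.
  by rewrite RintegralZl// (gaussian_coordM mZ gZ i i').2 eq_sym (negbTE i'i) mulr0.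
have mn : measurable_fun setT (fun t => enorm (Z t *m M)).
  apply: (@measurableT_comp _ _ _ _ _ _ (@enorm R l) _ (fun t => Z t *m M)).
    exact: measurable_enorm.
  apply: measurable_rV => j.
  under eq_fun do rewrite mxE.
  by apply: measurable_sum => i; exact: measurable_funM.
have [in1 le1] := Rintegral_norm_le_sqrt mn isq; split => //.
rewrite -Esq; apply: le_trans le1.
by under eq_Rintegral do rewrite -[enorm _]ger0_norm ?enorm_ge0//.
Qed.

Section Kernel.
Variables (g : 'rV[R]_k -> R) (B L1 L2 : R).
Hypothesis dg : forall x, differentiable g x.
Hypothesis gB : forall x, `|g x| <= B.
Hypothesis GL1 : forall x, enorm (gradient g x) <= L1.
Hypothesis GL2 : forall x y,
  enorm (gradient g x - gradient g y) <= L2 * enorm (x - y).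
Variables (s c : R).

Notation G := (gradient g).
Notation mix w t := (s *: w + c *: Z t).

Lemma continuous_gradient j : continuous (fun x => gradient g x 0 j).
Proof.
apply: (@lipschitz_enorm_continuous _ _ _ L2) => x y.
have -> : gradient g x 0 j - gradient g y 0 j = (gradient g x - gradient g y) 0 j.
  by rewrite !mxE.
exact: (le_trans (coord_le_enorm _ _) (GL2 _ _)).
Qed.

Let mX w : measurable_fun setT (fun t => mix w t).
Proof. exact: measurable_affine. Qed.

Let mGX w j : measurable_fun setT (fun t => G (mix w t) 0 j).
Proof.
apply: (@measurableT_comp _ _ _ _ _ _ (fun x => G x 0 j) _ (fun t => mix w t)) => //.
exact: continuous_measurable_matrix (@continuous_gradient j).
Qed.

Let mgX w : measurable_fun setT (fun t => g (mix w t)).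
Proof.
apply: (@measurableT_comp _ _ _ _ _ _ g _ (fun t => mix w t)) => //.
by apply: continuous_measurable_matrix => x; exact: differentiable_continuous.
Qed.

Let L10 : 0 <= L1 := le_trans (enorm_ge0 _) (GL1 0).

Let G_le x j : `|G x 0 j| <= L1.
Proof. exact: le_trans (coord_le_enorm _ _) (GL1 x). Qed.

Let iGX w j : Int (fun t => G (mix w t) 0 j).
Proof. by apply: (@Rintegrable_bounded _ _ _ _ _ L1) => // t; exact: G_le. Qed.

Let iZGX i w j : Int (fun t => Z t 0 i * G (mix w t) 0 j).
Proof.
apply: (Rintegrable_dominated (h := fun t => L1 * `|Z t 0 i|)).
- exact: measurable_funM.
- by move=> t; rewrite normrM mulrC ler_wpM2r.
- exact: RintegrableZ (Rintegrable_norm (iZ i)).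
Qed.

(** Coordinate [j] of the field [F] of the overview; [smooth_dot w u] is then [F w . u]. *)
Definition smooth_coord (j : 'I_k) (w : 'rV[R]_k) : R := \int[P]_t G (mix w t) 0 j.
Definition smooth_dot (w u : 'rV[R]_k) : R := \sum_j smooth_coord j w * u 0 j.
(* When [s != 0], this is [c / s ^+ 2] times the second derivative of
   [w |-> E g (s w + c Z)] in the directions [i], [j], written by parts. *)
Definition stein_kernel (i j : 'I_k) (w : 'rV[R]_k) : R :=
  \int[P]_t (Z t 0 i * G (mix w t) 0 j).
(** The Frobenius pairing of [M] with [K w]. The identity gives the trace [tau], and [u^T *m u] the
    quadratic form of [K w] at [u]. *)
Definition stein_form (M : 'M[R]_k) (w : 'rV[R]_k) : R :=
  \sum_i \sum_j M i j * stein_kernel i j w.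

(** Moving [M] onto [Z] allows Cauchy-Schwarz inside the expectation, so that the pairing costs the
    Frobenius norm of [M] and not a sum over its entries. *)
Lemma stein_formE M w : Int (fun t => dotv (Z t *m M) (G (mix w t))) /\
  stein_form M w = \int[P]_t dotv (Z t *m M) (G (mix w t)).
Proof.
have E t : dotv (Z t *m M) (G (mix w t)) =
    \sum_i \sum_j M i j * (Z t 0 i * G (mix w t) 0 j).
  rewrite exchange_big/=; apply: eq_bigr => j _; rewrite !mxE big_distrl/=.
  by apply: eq_bigr => i _; ring.
have i2 i j : Int (fun t => M i j * (Z t 0 i * G (mix w t) 0 j)).
  exact: (RintegrableZ _ (iZGX i w j)).
have i1 i : Int (fun t => \sum_j M i j * (Z t 0 i * G (mix w t) 0 j)).
  exact: Rintegrable_sum.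
rewrite (funext E); split; first exact: Rintegrable_sum.
rewrite Rintegral_sum//; apply: eq_bigr => i _.
by rewrite Rintegral_sum//; apply: eq_bigr => j _; rewrite RintegralZl.
Qed.

Lemma stein_form_le M w :
  `|stein_form M w| <= L1 * Num.sqrt (\sum_i \sum_j M i j ^+ 2).
Proof.
have [iM ->] := stein_formE M w; have [_ _ iE le1] := gaussian_enorm_mulmx M.
apply: (@le_trans _ _ (\int[P]_t (L1 * enorm (Z t *m M)))).
  apply: normr_Rintegral_le; first exact: Rintegrable_measurable iM.
    exact: RintegrableZ.
  move=> t; apply: (le_trans (dotv_le _ _)); rewrite mulrC.
  by rewrite ler_wpM2r ?enorm_ge0.
by rewrite (RintegralZl _ measurableT iE) ler_wpM2l.
Qed.

Lemma stein_form_lipschitz M w w' : `|stein_form M w - stein_form M w'| <=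
  L2 * `|s| * Num.sqrt (\sum_i \sum_j M i j ^+ 2) * enorm (w - w').
Proof.
have [iM ->] := stein_formE M w; have [iM' ->] := stein_formE M w'.
have [_ _ iE le1] := gaussian_enorm_mulmx M.
rewrite -RintegralB//.
have XX t : enorm (mix w t - mix w' t) = `|s| * enorm (w - w').
  by rewrite opprD addrACA subrr addr0 -scalerBr enormZ.
(* The sign of the constant is read off the Lipschitz inequality itself, at an arbitrary sample
   point. *)
have [K0|K0] := leP 0 (L2 * (`|s| * enorm (w - w'))); last first.
  have := le_trans (enorm_ge0 _) (GL2 (mix w point) (mix w' point)).
  by rewrite XX => /(lt_le_trans K0); rewrite ltxx.
apply: (@le_trans _ _ (\int[P]_t (L2 * (`|s| * enorm (w - w')) * enorm (Z t *m M)))).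
  apply: normr_Rintegral_le.
  - exact: Rintegrable_measurable (RintegrableB iM iM').
  - exact: RintegrableZ.
  move=> t; rewrite -dotvBr; apply: (le_trans (dotv_le _ _)); rewrite mulrC.
  by rewrite ler_wpM2r ?enorm_ge0// -(XX t) GL2.
rewrite (RintegralZl _ measurableT iE) (le_trans (ler_wpM2l K0 le1))//.
by rewrite le_eqVlt; apply/orP; left; apply/eqP; ring.
Qed.

(** Transfers the estimates on [stein_form] to single entries: [delta_mx i j] has Frobenius norm
    1. *)
Lemma stein_kernelE i j w : stein_kernel i j w = stein_form (delta_mx i j) w.
Proof.
rewrite /stein_form (bigD1 i)//= [X in _ + X]big1 ?addr0 => [|i' ii']; last first.
  by apply: big1 => j' _; rewrite mxE (negbTE ii') mul0r.
rewrite (bigD1 j)//= big1 ?addr0 => [|j' jj']; last first.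
  by rewrite mxE (negbTE jj') andbF mul0r.
by rewrite mxE !eqxx mul1r.
Qed.

Lemma stein_kernel_le i j w : `|stein_kernel i j w| <= L1.
Proof.
rewrite stein_kernelE (le_trans (stein_form_le _ _))// ler_piMr//.
rewrite (bigD1 i)//= [X in _ + X]big1 ?addr0 => [|i' ii']; last first.
  by apply: big1 => j' _; rewrite mxE (negbTE ii') expr0n.
rewrite (bigD1 j)//= big1 ?addr0 => [|j' jj']; last first.
  by rewrite mxE (negbTE jj') andbF expr0n.
by rewrite mxE !eqxx expr1n sqrtr1.
Qed.

Lemma smooth_coord_lipschitz j w w' :
  `|smooth_coord j w - smooth_coord j w'| <= L2 * `|s| * enorm (w - w').
Proof.
rewrite /smooth_coord -RintegralB//; try exact: iGX.
rewrite -(Rintegral_prob_cst P (L2 * `|s| * enorm (w - w'))).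
apply: normr_Rintegral_le; [exact: measurable_funB|exact: Rintegrable_cst|].
move=> t; rewrite (_ : _ - _ = (G (mix w t) - G (mix w' t)) 0 j); last by rewrite !mxE.
apply: (le_trans (coord_le_enorm _ _)); apply: (le_trans (GL2 _ _)).
by rewrite opprD addrACA subrr addr0 -scalerBr enormZ mulrA.
Qed.

Lemma measurable_smooth_coord j : measurable_fun setT (smooth_coord j).
Proof.
apply: continuous_measurable_matrix.
exact: lipschitz_enorm_continuous (@smooth_coord_lipschitz j).
Qed.

Lemma measurable_stein_form M : measurable_fun setT (stein_form M).
Proof.
apply: continuous_measurable_matrix.
exact: lipschitz_enorm_continuous (@stein_form_lipschitz M).
Qed.

Lemma smooth_coord_le j w : `|smooth_coord j w| <= L1.
Proof.
rewrite -(Rintegral_prob_cst P L1); apply: normr_Rintegral_le => //.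
exact: Rintegrable_cst.
Qed.

Lemma smooth_dotE w u : Int (fun t => dotv (G (mix w t)) u) /\
  smooth_dot w u = \int[P]_t dotv (G (mix w t)) u.
Proof.
have i1 j : Int (fun t => G (mix w t) 0 j * u 0 j).
  by under eq_fun do rewrite mulrC; exact: (RintegrableZ (u 0 j) (iGX w j)).
split; first exact: Rintegrable_sum.
by rewrite Rintegral_sum//; apply: eq_bigr => j _; rewrite RintegralZr.
Qed.

(** Integration by parts read backwards: the gradient becomes a factor [Z . u], and increments of
    [F] become increments of [g]. *)
Lemma smooth_dot_by_parts w u : Int (fun t => dotv (Z t) u * g (mix w t)) /\
  c * smooth_dot w u = \int[P]_t (dotv (Z t) u * g (mix w t)).
Proof.
have i0 j : Int (fun t => Z t 0 j * g (mix w t)).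
  apply: (Rintegrable_dominated (h := fun t => B * `|Z t 0 j|)).
  - exact: measurable_funM.
  - by move=> t; rewrite normrM mulrC ler_wpM2r.
  - exact: RintegrableZ (Rintegrable_norm (iZ j)).
have i1 j : Int (fun t => u 0 j * (Z t 0 j * g (mix w t))).
  exact: (RintegrableZ _ (i0 j)).
have E t : dotv (Z t) u * g (mix w t) = \sum_j u 0 j * (Z t 0 j * g (mix w t)).
  by rewrite mulr_suml; apply: eq_bigr => j _; ring.
rewrite (funext E); split; first exact: Rintegrable_sum.
rewrite Rintegral_sum// mulr_sumr; apply: eq_bigr => j _.
rewrite RintegralZl// (gaussian_integration_by_parts mZ gZ dg gB GL1)//.
  by rewrite /smooth_coord; ring.
exact: continuous_gradient.
Qed.

(** After integration by parts all terms carry the factor [Z . u], and what multiplies it is the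
    Taylor remainder of [g] for the step [s u]. That remainder gives [s ^ 2 |u| ^ 2]; the third
    power of [|u|] comes from [E |Z . u| <= |u|]. *)
Lemma smooth_dot_increment w u :
  `|c * (smooth_dot (w + u) u - smooth_dot w u) - s * stein_form (u^T *m u) w|
  <= s ^+ 2 * (L2 / 2 * enorm u ^+ 3).
Proof.
have [iS' ES'] := smooth_dot_by_parts (w + u) u.
have [iS ES] := smooth_dot_by_parts w u.
have [iM ->] := stein_formE (u^T *m u) w.
have dE t : dotv (Z t *m (u^T *m u)) (G (mix w t)) =
    dotv (Z t) u * dotv (G (mix w t)) u.
  rewrite mulmxA (_ : Z t *m u^T = (dotv (Z t) u)%:M); last first.
    apply/matrixP => i j; rewrite !ord1 !mxE eqxx mulr1n; apply: eq_bigr => l _.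
    by rewrite mxE.
  by rewrite mul_scalar_mx dotvZl [in X in _ * X]dotvC.
have iB := RintegrableB iS' iS; have iMs := RintegrableZ s iM.
rewrite mulrBr [X in X - _ - _]ES' [X in _ - X - _]ES.
rewrite -(RintegralB measurableT iS' iS) -(RintegralZl s measurableT iM).
rewrite -(RintegralB measurableT iB iMs).
have [_ _ iE le1] := gaussian_enorm_mulmx u^T.
(* [Z . u] is the one-entry matrix [Z *m u^T], so the moment bound for [|Z M|] applies with
   [M = u^T]. *)
have EZ t : `|dotv (Z t) u| = enorm (Z t *m u^T).
  rewrite enormE /dotv big_ord1 -expr2 sqrtr_sqr mxE; congr `|_|.
  by apply: eq_bigr => j _; rewrite mxE.
have Eu : \sum_i \sum_j u^T i j ^+ 2 = enorm u ^+ 2.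
  rewrite sqr_enorm; apply: eq_bigr => i _.
  by rewrite big_ord1 mxE expr2.
have b0 : 0 <= s ^+ 2 * (L2 / 2 * enorm u ^+ 2).
  rewrite mulr_ge0 ?sqr_ge0//.
  exact: le_trans (normr_ge0 _) (taylor_lipschitz_gradient dg GL2 0 u).
apply: (@le_trans _ _
  (\int[P]_t (s ^+ 2 * (L2 / 2 * enorm u ^+ 2) * enorm (Z t *m u^T)))).
  apply: normr_Rintegral_le.
  - exact: Rintegrable_measurable (RintegrableB iB iMs).
  - exact: RintegrableZ.
  move=> t; rewrite dE.
  have -> : mix (w + u) t = mix w t + s *: u by rewrite scalerDr addrAC.
  rewrite (_ : _ - _ - _ = dotv (Z t) u *
    (g (mix w t + s *: u) - g (mix w t) - dotv (G (mix w t)) (s *: u))); last first.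
    by rewrite dotvZr; ring.
  rewrite normrM EZ mulrC ler_wpM2r ?enorm_ge0//.
  apply: (le_trans (taylor_lipschitz_gradient dg GL2 _ _)).
  by rewrite enormZ exprMn real_normK ?num_real// mulrCA.
rewrite (RintegralZl _ measurableT iE) (le_trans (ler_wpM2l b0 le1))//.
rewrite Eu sqrtr_sqr ger0_norm ?enorm_ge0//.
by rewrite le_eqVlt; apply/orP; left; apply/eqP; ring.
Qed.

End Kernel.
End Smoothing.

(** * Sums of independent vectors *)

Lemma sum_delta (R : pzSemiRingType) (k : nat) :
  \sum_(a < k) \sum_(b < k) (a == b)%:R = k%:R :> R.
Proof.
rewrite -[X in _ = X%:R]card_ord -sumr_const; apply: eq_bigr => a _.
rewrite (bigD1 a)//= eqxx big1 ?addr0// => b ba.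
by rewrite eq_sym (negbTE ba).
Qed.

Lemma ler_dist_mul_trans (R : realDomainType) (x y z s a b : R) :
  `|x - s * y| <= a -> `|y - z| <= b -> `|x - s * z| <= a + `|s| * b.
Proof.
move=> xy yz; rewrite (_ : x - s * z = (x - s * y) + s * (y - z)); last by ring.
by apply: (le_trans (ler_normD _ _)); rewrite lerD// normrM ler_wpM2l.
Qed.

Section SumOfIndependent.
Context {R : realType} {k n : nat} d (T : measurableType d) (P : probability T R)
  (U : 'I_n -> T -> 'rV[R]_k).
Context d' (T' : measurableType d') (P' : probability T' R) (Z : T' -> 'rV[R]_k).
Notation Int f := (P.-integrable setT (EFin \o f)).
Hypothesis n0 : (0 < n)%N.
Hypothesis mU : forall i, measurable_fun setT (U i).
Hypothesis iU : mutually_independent P U.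
Hypothesis U1 : forall i a, Int (fun t => U i t 0 a) /\ \int[P]_t U i t 0 a = 0.
Hypothesis U2 : forall i a b, Int (fun t => U i t 0 a * U i t 0 b) /\
  \int[P]_t (U i t 0 a * U i t 0 b) = (a == b)%:R / n%:R.
Variables m3 m4 : R.
Hypothesis U3 : forall i, Int (fun t => enorm (U i t) ^+ 3) /\
  \int[P]_t enorm (U i t) ^+ 3 = m3.
Hypothesis U4 : forall i, Int (fun t => enorm (U i t) ^+ 4) /\
  \int[P]_t enorm (U i t) ^+ 4 = m4.
Hypothesis mZ : measurable_fun setT Z.
Hypothesis gZ : standard_gaussian P' Z.
Variables (g : 'rV[R]_k -> R) (B L1 L2 : R).
Hypothesis dg : forall x, differentiable g x.
Hypothesis gB : forall x, `|g x| <= B.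
Hypothesis GL1 : forall x, enorm (gradient g x) <= L1.
Hypothesis GL2 : forall x y,
  enorm (gradient g x - gradient g y) <= L2 * enorm (x - y).
Hypothesis L20 : 0 <= L2.

Let mUa i a : measurable_fun setT (fun t => U i t 0 a) := measurable_coord a (mU i).
Let iU1 i a : Int (fun t => U i t 0 a) := (U1 i a).1.
Let iU2 i a b : Int (fun t => U i t 0 a * U i t 0 b) := (U2 i a b).1.
Let L10 : 0 <= L1 := le_trans (enorm_ge0 _) (GL1 0).

Let W t := \sum_i U i t.
Let V i t := \sum_(j | j != i) U j t.

Let WE i t : W t = V i t + U i t.
Proof. by rewrite /W (bigD1 i)//= addrC. Qed.

(** Measurability for the sigma-algebra of the other summands is what allows [V i] to be frozen
    while [U i] is averaged. *)
Let mV i :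
  measurable_fun setT (V i : g_sigma_algebraType (other_events U i) -> 'rV[R]_k).
Proof.
apply: measurable_rV => a.
rewrite (_ : (fun t => _) = (fun t => \sum_j if j != i then U j t 0 a else 0));
  last first.
  by apply/funext => t; rewrite summxE; exact: big_mkcond.
apply: measurable_sum => j; case: (eqVneq j i) => [_|ji] /=.
  exact: measurable_cst.
exact: (measurable_coord a (measurable_other_events (X := U) ji)).
Qed.

Let mVT i : measurable_fun setT (V i) := measurable_of_others mU (@mV i).

Let mW : measurable_fun setT W.
Proof.
apply: measurable_rV => a; under eq_fun do rewrite summxE.
exact: measurable_sum.
Qed.

Lemma second_moment_summand i : Int (fun t => enorm (U i t) ^+ 2) /\
  \int[P]_t enorm (U i t) ^+ 2 = k%:R / n%:R.
Proof.
under eq_fun do rewrite sqr_enorm.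
split; first exact: Rintegrable_sum.
rewrite Rintegral_sum//; under eq_bigr do rewrite (U2 i _ _).2 eqxx mul1r.
by rewrite sumr_const card_ord mulr_natl.
Qed.

Lemma first_moment_summand i : Int (fun t => enorm (U i t)) /\
  \int[P]_t enorm (U i t) <= Num.sqrt (k%:R / n%:R).
Proof.
have [i2 <-] := second_moment_summand i.
have [|i1] := Rintegral_norm_le_sqrt _ i2.
  apply: (@measurableT_comp _ _ _ _ _ _ (@enorm R k) _ (U i)) => //.
  exact: measurable_enorm.
by under eq_Rintegral do rewrite ger0_norm ?enorm_ge0//.
Qed.

(** The centred entries of [U_i^T U_i]. For distinct [i] they are uncorrelated, by independence. *)
Let xi i a b t : R := U i t 0 a * U i t 0 b - (a == b)%:R / n%:R.

Let mxi i a b : measurable_fun setT (xi i a b).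
Proof. by apply: measurable_funB => //; exact: measurable_funM. Qed.

Let iUsq i a b : Int (fun t => (U i t 0 a * U i t 0 b) ^+ 2).
Proof.
apply: (Rintegrable_dominated (h := fun t => enorm (U i t) ^+ 4)).
- by apply: measurable_funX; exact: measurable_funM.
- move=> t; rewrite ger0_norm ?sqr_ge0// exprMn -[4%N]/(2 + 2)%N exprD.
  by apply: ler_pM; rewrite ?sqr_ge0// -real_normK ?num_real// ler_pXn2r ?nnegrE
    ?enorm_ge0// coord_le_enorm.
- exact: (U4 i).1.
Qed.

Let ixi i a b : Int (xi i a b) /\ \int[P]_t xi i a b t = 0.
Proof.
split; first exact: RintegrableB (iU2 i a b) (Rintegrable_cst _ _).
rewrite RintegralB// ?(U2 i a b).2; last exact: Rintegrable_cst.
by rewrite Rintegral_prob_cst subrr.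
Qed.

Let ixi2 i a b : Int (fun t => xi i a b t * xi i a b t) /\
  \int[P]_t (xi i a b t * xi i a b t) =
  \int[P]_t (U i t 0 a * U i t 0 b) ^+ 2 - (a == b)%:R / n%:R ^+ 2.
Proof.
set e := (a == b)%:R / n%:R : R.
have E t : xi i a b t * xi i a b t =
    (U i t 0 a * U i t 0 b) ^+ 2 - (2 * e) * (U i t 0 a * U i t 0 b) + e ^+ 2.
  by rewrite /xi -/e; ring.
have i1 : Int (fun t => (2 * e) * (U i t 0 a * U i t 0 b)).
  exact: (RintegrableZ _ (iU2 i a b)).
have i2 := RintegrableB (iUsq i a b) i1.
rewrite (funext E); split; first exact: RintegrableD i2 (Rintegrable_cst _ _).
rewrite RintegralD//; last exact: Rintegrable_cst.
rewrite RintegralB// RintegralZl// (U2 i a b).2 Rintegral_prob_cst -/e.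
rewrite -addrA; congr (_ + _).
have -> : (a == b)%:R / n%:R ^+ 2 = e ^+ 2 :> R.
  by rewrite /e; case: eqP => _; rewrite ?mul0r ?expr0n// !mul1r exprVn.
by ring.
Qed.

Let ixixj i j a b : Int (fun t => xi i a b t * xi j a b t).
Proof.
apply: (Rintegrable_dominated (h := fun t => xi i a b t * xi i a b t
   + xi j a b t * xi j a b t)).
- exact: measurable_funM.
- move=> t; rewrite ler_norml.
  have := sqr_ge0 (xi i a b t - xi j a b t); have := sqr_ge0 (xi i a b t + xi j a b t).
  by have := sqr_ge0 (xi i a b t); have := sqr_ge0 (xi j a b t); nra.
- exact: RintegrableD (ixi2 i a b).1 (ixi2 j a b).1.
Qed.

Let E_xixj i j a b : j != i -> \int[P]_t (xi i a b t * xi j a b t) = 0.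
Proof.
move=> ji.
pose f (u : 'rV[R]_k) : R := u 0 a * u 0 b - (a == b)%:R / n%:R.
have mf : measurable_fun setT f.
  by apply: measurable_funB => //; apply: measurable_funM; exact: measurable_coord.
under eq_Rintegral do rewrite mulrC.
rewrite (@Rintegral_indep_others _ _ _ _ T _ 'rV[R]_k P _ _ mU iU i (U j)
  (fun vu => f vu.1 * f vu.2)).
- rewrite -[RHS](Rintegral_prob_cst P 0); apply: eq_Rintegral => t _ /=.
  by rewrite RintegralZl ?(ixi i a b).2 ?mulr0//; exact: (ixi i a b).1.
- exact: measurable_other_events.
- apply: measurable_funM.
    exact: (@measurableT_comp _ _ _ _ _ _ f _ fst).
  exact: (@measurableT_comp _ _ _ _ _ _ f _ snd).
- exact: (ixixj j i a b).
- by move=> v; exact: (RintegrableZ (f v) (ixi i a b).1).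
Qed.

Let cov t : 'M[R]_k := \sum_i (U i t)^T *m U i t - 1%:M.

(** In the mean square of the Frobenius norm only the terms [i = j] survive. Summed over [a, b], the
    squares [(U_a U_b) ^ 2] give [|U| ^ 4] and the squared means give [k / n ^ 2]. For
    [U = Y / sqrt n] this is [(E |Y_1| ^ 4 - k) / n]. *)
Lemma empirical_covariance_deviation :
  Int (fun t => Num.sqrt (\sum_a \sum_b cov t a b ^+ 2)) /\
  \int[P]_t Num.sqrt (\sum_a \sum_b cov t a b ^+ 2) <=
  Num.sqrt (n%:R * (m4 - k%:R / n%:R ^+ 2)).
Proof.
have covE t a b : cov t a b = \sum_i xi i a b t.
  rewrite /cov !mxE summxE /xi sumrB; congr (_ - _).
    by apply: eq_bigr => i _; rewrite !mxE big_ord1 mxE.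
  by rewrite sumr_const card_ord -[RHS]mulr_natl mulrC divfK// pnatr_eq0 -lt0n.
have sqE t : \sum_a \sum_b cov t a b ^+ 2 =
    \sum_a \sum_b \sum_i \sum_j xi i a b t * xi j a b t.
  apply: eq_bigr => a _; apply: eq_bigr => b _.
  by rewrite covE expr2 mulr_suml; apply: eq_bigr => i _; rewrite mulr_sumr.
have i3 a b i : Int (fun t => \sum_j xi i a b t * xi j a b t) by exact: Rintegrable_sum.
have i2 a b : Int (fun t => \sum_i \sum_j xi i a b t * xi j a b t).
  exact: Rintegrable_sum.
have i1 a : Int (fun t => \sum_b \sum_i \sum_j xi i a b t * xi j a b t).
  exact: Rintegrable_sum.
have i0 : Int (fun t => \sum_a \sum_b cov t a b ^+ 2).
  by rewrite (funext sqE); exact: Rintegrable_sum.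
have E : \int[P]_t (\sum_a \sum_b cov t a b ^+ 2) = n%:R * (m4 - k%:R / n%:R ^+ 2).
  rewrite (funext sqE) Rintegral_sum//.
  transitivity (\sum_a \sum_b \sum_i (\int[P]_t (U i t 0 a * U i t 0 b) ^+ 2
       - (a == b)%:R / n%:R ^+ 2)).
    apply: eq_bigr => a _; rewrite Rintegral_sum//; apply: eq_bigr => b _.
    rewrite Rintegral_sum//; apply: eq_bigr => i _; rewrite Rintegral_sum//.
    by rewrite (bigD1 i)//= big1 ?addr0 ?(ixi2 i a b).2// => j ji; exact: E_xixj.
  under eq_bigr do rewrite exchange_big/=.
  rewrite exchange_big/=.
  transitivity (\sum_(i < n) (m4 - k%:R / n%:R ^+ 2)); last first.
    by rewrite sumr_const card_ord [RHS]mulr_natl.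
  apply: eq_bigr => i _; under eq_bigr do rewrite sumrB.
  rewrite sumrB; congr (_ - _).
    rewrite -(U4 i).2; under eq_bigr do rewrite -Rintegral_sum//.
    rewrite -Rintegral_sum; last by move=> a; exact: Rintegrable_sum.
    apply: eq_Rintegral => t _; rewrite -[4%N]/(2 * 2)%N exprM sqr_enorm.
    rewrite [RHS]expr2 mulr_suml; apply: eq_bigr => a _; rewrite mulr_sumr.
    by apply: eq_bigr => b _; ring.
  by rewrite -(sum_delta R k) mulr_suml; apply: eq_bigr => a _; rewrite mulr_suml.
have sq0 t : 0 <= \sum_a \sum_b cov t a b ^+ 2.
  by apply: sumr_ge0 => a _; apply: sumr_ge0 => b _; exact: sqr_ge0.
have msq : measurable_fun setT (fun t => Num.sqrt (\sum_a \sum_b cov t a b ^+ 2)).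
  apply: (@measurableT_comp _ _ _ _ _ _ (@Num.sqrt R) _
    (fun t => \sum_a \sum_b cov t a b ^+ 2)).
    apply: continuous_measurable_fun; exact: sqrt_continuous.
  exact: Rintegrable_measurable i0.
have isq : Int (fun t => Num.sqrt (\sum_a \sum_b cov t a b ^+ 2) ^+ 2).
  by under eq_fun do rewrite sqr_sqrtr//.
have [ic] := Rintegral_norm_le_sqrt msq isq.
under [X in Num.sqrt X]eq_Rintegral do rewrite sqr_sqrtr//.
rewrite E => le1; split=> //; apply: le_trans le1.
by under [X in _ <= X]eq_Rintegral do rewrite ger0_norm ?sqrtr_ge0//.
Qed.

(** * The two leave-one-out bounds at a fixed point of the circle *)

Section Interpolation.
Variables s c : R.
Notation SD := (smooth_dot P' Z g s c).
Notation SF := (stein_form P' Z g s c).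
Notation SC := (smooth_coord P' Z g s c).
Notation SK := (stein_kernel P' Z g s c).

Let mSC a : measurable_fun setT (SC a) := measurable_smooth_coord P' mZ GL1 GL2 s c a.
Let mSK a b : measurable_fun setT (SK a b).
Proof.
rewrite (funext (stein_kernelE _ _ _ _ _ _ _)).
exact: (measurable_stein_form mZ gZ GL1 GL2).
Qed.

Let SC_le a w : `|SC a w| <= L1. Proof. exact: (smooth_coord_le P' mZ GL1 GL2). Qed.
Let SK_le a b w : `|SK a b w| <= L1. Proof. exact: (stein_kernel_le mZ gZ GL1 GL2). Qed.

Lemma smooth_dot_integrable i f : measurable_fun setT f ->
  Int (fun t => SD (f t) (U i t)).
Proof.
move=> mf; apply: Rintegrable_sum => a.
apply: (Rintegrable_dominated (h := fun t => L1 * `|U i t 0 a|)).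
- apply: measurable_funM => //.
  exact: (@measurableT_comp _ _ _ _ _ _ (SC a) _ f).
- by move=> t; rewrite normrM ler_wpM2r.
- exact: (RintegrableZ _ (Rintegrable_norm (iU1 i a))).
Qed.

Let SF_outer (w u : 'rV[R]_k) :
  SF (u^T *m u) w = \sum_a \sum_b SK a b w * (u 0 a * u 0 b).
Proof.
apply: eq_bigr => a _; apply: eq_bigr => b _; rewrite !mxE big_ord1 mxE; ring.
Qed.

Let iSF i f : measurable_fun setT f -> Int (fun t => SF ((U i t)^T *m U i t) (f t)).
Proof.
move=> mf; under eq_fun do rewrite SF_outer.
apply: Rintegrable_sum => a; apply: Rintegrable_sum => b.
apply: (Rintegrable_dominated (h := fun t => L1 * `|U i t 0 a * U i t 0 b|)).
- apply: measurable_funM; last exact: measurable_funM.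
  exact: (@measurableT_comp _ _ _ _ _ _ (SK a b) _ f).
- by move=> t; rewrite normrM ler_wpM2r.
- exact: (RintegrableZ _ (Rintegrable_norm (iU2 i a b))).
Qed.

Lemma stein_form_integrable f (M : 'M[R]_k) : measurable_fun setT f ->
  Int (fun t => SF M (f t)).
Proof.
move=> mf; apply: (@Rintegrable_bounded _ _ _ _ _
  (L1 * Num.sqrt (\sum_i \sum_j M i j ^+ 2))).
  apply: (@measurableT_comp _ _ _ _ _ _ (SF M) _ f) => //.
  exact: (measurable_stein_form mZ gZ GL1 GL2).
by move=> t; exact: (stein_form_le mZ gZ GL1 GL2).
Qed.

(** With [V i] frozen this is linear in the centred vector [U i]; hence [F (V i) . U i] can be
    subtracted at no cost, which creates the increments of [F]. *)
Let E_SD_others i : \int[P]_t SD (V i t) (U i t) = 0.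
Proof.
rewrite (@Rintegral_indep_others _ _ _ _ T _ 'rV[R]_k P _ _ mU iU i (V i)
  (fun vu => SD vu.1 vu.2)).
- rewrite -[RHS](Rintegral_prob_cst P 0); apply: eq_Rintegral => t _ /=.
  rewrite Rintegral_sum => [|a]; last exact: (RintegrableZ _ (iU1 i a)).
  by apply: big1 => a _; rewrite RintegralZl// (U1 i a).2 mulr0.
- exact: mV.
- apply: measurable_sum => a; apply: measurable_funM.
    exact: (@measurableT_comp _ _ _ _ _ _ (SC a) _ fst).
  exact: measurable_coord _ measurable_snd.
- exact: (smooth_dot_integrable i (mVT i)).
- by move=> v; exact: (smooth_dot_integrable i (measurable_cst v)).
Qed.

Let E_SF_others i :
  \int[P]_t SF ((U i t)^T *m U i t) (V i t) = n%:R^-1 * \int[P]_t SF 1%:M (V i t).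
Proof.
rewrite -RintegralZl//; last exact: stein_form_integrable.
rewrite (@Rintegral_indep_others _ _ _ _ T _ 'rV[R]_k P _ _ mU iU i (V i)
  (fun vu => SF (vu.2^T *m vu.2) vu.1)).
- apply: eq_Rintegral => t _ /=; under eq_Rintegral do rewrite SF_outer.
  have i2 v a b : Int (fun t => SK a b v * (U i t 0 a * U i t 0 b)).
    exact: (RintegrableZ _ (iU2 i a b)).
  rewrite Rintegral_sum => [|a]; last exact: Rintegrable_sum.
  rewrite mulr_sumr; apply: eq_bigr => a _; rewrite Rintegral_sum// mulr_sumr.
  apply: eq_bigr => b _; rewrite RintegralZl// (U2 i a b).2 mxE.
  by case: eqP => _; rewrite /=; ring.
- exact: mV.
- rewrite (_ : (fun vu => _) = fun vu : 'rV[R]_k * 'rV[R]_k =>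
     \sum_a \sum_b SK a b vu.1 * (vu.2 0 a * vu.2 0 b)).
    apply: measurable_sum => a; apply: measurable_sum => b; apply: measurable_funM.
      exact: (@measurableT_comp _ _ _ _ _ _ (SK a b) _ fst).
    by apply: measurable_funM; exact: measurable_coord _ measurable_snd.
  by apply/funext => vu; rewrite SF_outer.
- exact: (iSF i (mVT i)).
- by move=> v; exact: (iSF i (measurable_cst v)).
Qed.

Let tau := SF 1%:M.

Let increment_V i t :
  `|c * (SD (W t) (U i t) - SD (V i t) (U i t)) - s * SF ((U i t)^T *m U i t) (V i t)|
  <= s ^+ 2 * (L2 / 2) * enorm (U i t) ^+ 3.
Proof.
by rewrite (WE i) -mulrA; exact: (smooth_dot_increment mZ gZ dg gB GL1 GL2).
Qed.

(** The increment estimate based at [W t] with the step [- U i t], which ends at [V i t]. The outer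
    product is even in the step, and the signs of the increment and of the direction cancel. *)
Let increment_W i t :
  `|c * (SD (W t) (U i t) - SD (V i t) (U i t)) - s * SF ((U i t)^T *m U i t) (W t)|
  <= s ^+ 2 * (L2 / 2) * enorm (U i t) ^+ 3.
Proof.
have SDN w u : SD w (- u) = - SD w u.
  by rewrite -sumrN; apply: eq_bigr => a _; rewrite mxE mulrN.
have := smooth_dot_increment mZ gZ dg gB GL1 GL2 s c (W t) (- U i t).
have -> : (- U i t)^T *m - U i t = (U i t)^T *m U i t.
  by rewrite [(- _)^T]linearN mulNmx mulmxN opprK.
have -> : W t - U i t = V i t by rewrite (WE i) addrK.
rewrite !SDN enormN; move: (SD _ _) (SD _ _) (SF _ _) => x y z.
by rewrite opprK [- y + x]addrC mulrA.
Qed.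

Let iinc i : Int (fun t => c * (SD (W t) (U i t) - SD (V i t) (U i t))).
Proof.
have i1 := smooth_dot_integrable i mW; have i2 := smooth_dot_integrable i (@mVT i).
exact: RintegrableZ (RintegrableB i1 i2).
Qed.

Let E_inc i : \int[P]_t (c * (SD (W t) (U i t) - SD (V i t) (U i t))) =
  c * \int[P]_t SD (W t) (U i t).
Proof.
have i1 := smooth_dot_integrable i mW; have i2 := smooth_dot_integrable i (@mVT i).
rewrite (RintegralZl _ measurableT (RintegrableB i1 i2)).
rewrite (RintegralB measurableT i1 i2).
by rewrite [X in _ - X](E_SD_others i) subr0.
Qed.

Let icub i : Int (fun t => s ^+ 2 * (L2 / 2) * enorm (U i t) ^+ 3).
Proof. exact: RintegrableZ (U3 i).1. Qed.

Let E_cub i : \int[P]_t (s ^+ 2 * (L2 / 2) * enorm (U i t) ^+ 3) =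
  s ^+ 2 * (L2 / 2) * m3.
Proof. by rewrite (RintegralZl _ measurableT (U3 i).1) (U3 i).2. Qed.

Let leave_one_out_V i :
  `|c * \int[P]_t SD (W t) (U i t) - s / n%:R * \int[P]_t tau (V i t)|
  <= s ^+ 2 * (L2 / 2) * m3.
Proof.
have iS := iSF i (@mVT i).
rewrite -E_inc -mulrA -E_SF_others -(RintegralZl _ measurableT iS).
rewrite -(RintegralB measurableT (iinc i) (RintegrableZ s iS)) -(E_cub i).
apply: normr_Rintegral_le; [|exact: icub|exact: (increment_V i)].
exact: Rintegrable_measurable (RintegrableB (iinc i) (RintegrableZ s iS)).
Qed.

Let leave_one_out_W i :
  `|c * \int[P]_t SD (W t) (U i t) - s * \int[P]_t SF ((U i t)^T *m U i t) (W t)|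
  <= s ^+ 2 * (L2 / 2) * m3.
Proof.
have iS := iSF i mW.
rewrite -E_inc -(RintegralZl _ measurableT iS).
rewrite -(RintegralB measurableT (iinc i) (RintegrableZ s iS)) -(E_cub i).
apply: normr_Rintegral_le; [|exact: icub|exact: (increment_W i)].
exact: Rintegrable_measurable (RintegrableB (iinc i) (RintegrableZ s iS)).
Qed.

(** The Frobenius norm [sqrt k] of the identity times [E |U_i| <= sqrt (k / n)] gives
    [k / sqrt n]. *)
Let tau_V i : `|\int[P]_t tau (V i t) - \int[P]_t tau (W t)| <=
  L2 * `|s| * (k%:R / Num.sqrt n%:R).
Proof.
have iV : Int (fun t => tau (V i t)) := stein_form_integrable _ (@mVT i).
have iW : Int (fun t => tau (W t)) := stein_form_integrable _ mW.
have [i1 le1] := first_moment_summand i.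
have b0 : 0 <= L2 * `|s| * Num.sqrt k%:R by rewrite !mulr_ge0 ?sqrtr_ge0.
rewrite -(RintegralB measurableT iV iW).
apply: (@le_trans _ _ (\int[P]_t (L2 * `|s| * Num.sqrt k%:R * enorm (U i t)))).
  apply: normr_Rintegral_le.
  - exact: Rintegrable_measurable (RintegrableB iV iW).
  - exact: RintegrableZ.
  move=> t; apply: (le_trans (stein_form_lipschitz mZ gZ GL1 GL2 _ _ _ _ _)).
  rewrite (WE i) opprD addrA subrr add0r enormN ler_wpM2r ?enorm_ge0//.
  rewrite (_ : \sum_a \sum_b _ = k%:R)// -(sum_delta R k).
  apply: eq_bigr => a _; apply: eq_bigr => b _; rewrite mxE.
  by case: eqP => _; rewrite ?expr0n ?expr1n.
rewrite (RintegralZl _ measurableT i1) (le_trans (ler_wpM2l b0 le1))//.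
suff -> : k%:R / Num.sqrt n%:R = Num.sqrt k%:R * Num.sqrt (k%:R / n%:R) :> R.
  by rewrite mulrA.
by rewrite sqrtrM// sqrtrV// mulrA -expr2 sqr_sqrtr.
Qed.

Lemma interpolation_bound_V :
  `|c * \sum_i \int[P]_t SD (W t) (U i t) - s * \int[P]_t tau (W t)| <=
  s ^+ 2 * L2 * (n%:R * m3 / 2 + k%:R / Num.sqrt n%:R).
Proof.
have nn : n%:R != 0 :> R by rewrite pnatr_eq0 -lt0n.
have -> : c * (\sum_i \int[P]_t SD (W t) (U i t)) - s * \int[P]_t tau (W t) =
    \sum_i (c * (\int[P]_t SD (W t) (U i t)) - s / n%:R * \int[P]_t tau (W t)).
  rewrite sumrB -mulr_sumr; congr (_ - _); rewrite sumr_const card_ord -[RHS]mulr_natl.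
  by field.
apply: (le_trans (ler_norm_sum _ _ _)).
have -> : s ^+ 2 * L2 * (n%:R * m3 / 2 + k%:R / Num.sqrt n%:R) = \sum_(i < n)
   (s ^+ 2 * (L2 / 2) * m3 + `|s| / n%:R * (L2 * `|s| * (k%:R / Num.sqrt n%:R))).
  rewrite sumr_const card_ord -[RHS]mulr_natl.
  rewrite -(real_normK (num_real s)); field.
  by rewrite nn andbT sqrtr_eq0 -ltNge ltr0n.
apply: ler_sum => i _.
have -> : `|s| / n%:R = `|s / n%:R| by rewrite normrM normfV (ger0_norm (ler0n _ _)).
exact: ler_dist_mul_trans (leave_one_out_V i) (tau_V i).
Qed.

Lemma interpolation_bound_W :
  `|c * \sum_i \int[P]_t SD (W t) (U i t) - s * \int[P]_t tau (W t)| <=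
  s ^+ 2 * L2 * (n%:R * m3 / 2) +
  `|s| * (L1 * Num.sqrt (n%:R * (m4 - k%:R / n%:R ^+ 2))).
Proof.
have iW : Int (fun t => tau (W t)) := stein_form_integrable _ mW.
have iS i := iSF i mW.
have [icov lecov] := empirical_covariance_deviation.
have SFB M N w : SF (M - N) w = SF M w - SF N w.
  rewrite -sumrB; apply: eq_bigr => a _; rewrite -sumrB; apply: eq_bigr => b _.
  by rewrite !mxE mulrBl.
have SFsum (M : 'I_n -> 'M[R]_k) w : SF (\sum_i M i) w = \sum_i SF (M i) w.
  rewrite exchange_big; apply: eq_bigr => a _; rewrite exchange_big.
  by apply: eq_bigr => b _; rewrite summxE mulr_suml.
(* Summed over [i], the outer products minus the identity form the covariance defect, paired with
   the single matrix [K (W t)]; this needs the kernel at [W] and not at [V i]. *)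
have Ecov : \sum_i \int[P]_t SF ((U i t)^T *m U i t) (W t) - \int[P]_t tau (W t) =
    \int[P]_t SF (cov t) (W t).
  rewrite -(Rintegral_sum _ iS) -(RintegralB measurableT (Rintegrable_sum _ iS) iW).
  by apply: eq_Rintegral => t _; rewrite /cov SFB SFsum.
have covb : `|\int[P]_t SF (cov t) (W t)| <=
    L1 * Num.sqrt (n%:R * (m4 - k%:R / n%:R ^+ 2)).
  apply: (@le_trans _ _ (\int[P]_t (L1 * Num.sqrt (\sum_a \sum_b cov t a b ^+ 2)))).
    apply: normr_Rintegral_le.
    - under eq_fun do rewrite /cov SFB SFsum.
      exact: Rintegrable_measurable (RintegrableB (Rintegrable_sum _ iS) iW).
    - exact: RintegrableZ.
    - by move=> t; exact: (stein_form_le mZ gZ GL1 GL2).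
  by rewrite (RintegralZl _ measurableT icov) ler_wpM2l.
rewrite -Ecov in covb; apply: ler_dist_mul_trans covb.
rewrite !mulr_sumr -sumrB; apply: (le_trans (ler_norm_sum _ _ _)).
apply: (le_trans (ler_sum _ (fun i _ => leave_one_out_W i))).
rewrite sumr_const card_ord -[X in X <= _]mulr_natl.
by rewrite le_eqVlt; apply/orP; left; apply/eqP; field.
Qed.

End Interpolation.

(** * The interpolating function and its derivative *)

Let iW2 : Int (fun t => enorm (W t) ^+ 2).
Proof.
have E t : enorm (W t) ^+ 2 = \sum_a \sum_i \sum_j U i t 0 a * U j t 0 a.
  rewrite sqr_enorm; apply: eq_bigr => a _; rewrite summxE mulr_suml.
  by apply: eq_bigr => i _; rewrite mulr_sumr.
rewrite (funext E); apply: Rintegrable_sum => a; apply: Rintegrable_sum => i.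
apply: Rintegrable_sum => j.
apply: (Rintegrable_dominated
  (h := fun t => U i t 0 a * U i t 0 a + U j t 0 a * U j t 0 a)).
- exact: measurable_funM.
- move=> t; rewrite ler_norml.
  have := sqr_ge0 (U i t 0 a - U j t 0 a); have := sqr_ge0 (U i t 0 a + U j t 0 a).
  by have := sqr_ge0 (U i t 0 a); have := sqr_ge0 (U j t 0 a); nra.
- exact: RintegrableD.
Qed.

Notation Int' f := (P'.-integrable setT (EFin \o f)).

(** [W] and [Z] live on different probability spaces: averaging over [Z] with [w] fixed, and then
    over [W], replaces a joint law. *)
Let Psi x w : R := \int[P']_t g (sin x *: w + cos x *: Z t).

Let iPsi x w : Int' (fun t => g (sin x *: w + cos x *: Z t)).
Proof.
apply: (@Rintegrable_bounded _ _ _ _ _ B) => [|t]; last exact: gB.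
apply: (@measurableT_comp _ _ _ _ _ _ g _ (fun t => sin x *: w + cos x *: Z t)).
  by apply: continuous_measurable_matrix => y; exact: differentiable_continuous.
exact: measurable_affine.
Qed.

Let mPsi x : measurable_fun setT (Psi x).
Proof.
apply: continuous_measurable_matrix.
apply: (@lipschitz_enorm_continuous _ _ _ (L1 * `|sin x|)) => w w'.
rewrite -RintegralB// -(Rintegral_prob_cst P' (L1 * `|sin x| * _)).
apply: normr_Rintegral_le.
- exact: Rintegrable_measurable (RintegrableB (iPsi x w) (iPsi x w')).
- exact: Rintegrable_cst.
move=> t; apply: (le_trans (bounded_gradient_lipschitz dg _ _ GL1)).
by rewrite opprD addrACA subrr addr0 -scalerBr enormZ mulrA.
Qed.

(** Two errors add up: the Taylor remainder of [g], of order [|u| ^ 2] with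
    [|u| <= |h| (|w| + |z|)], and the gradient against the remainder of the circle itself, at most
    [h ^ 2 (|w| + |z|)]. The last factor dominates both [|w| + |z|] and its square, and is
    integrable. *)
Let rotation_taylor x h w z :
  `|g (sin (x + h) *: w + cos (x + h) *: z) - g (sin x *: w + cos x *: z)
    - h * dotv (gradient g (sin x *: w + cos x *: z)) (cos x *: w - sin x *: z)|
  <= h ^+ 2 * (L1 + L2) * (1 + 2 * enorm w ^+ 2 + 2 * enorm z ^+ 2).
Proof.
set y := sin x *: w + cos x *: z.
pose u := (sin (x + h) - sin x) *: w + (cos (x + h) - cos x) *: z.
pose r := (sin (x + h) - sin x - h * cos x) *: w
  + (cos (x + h) - cos x + h * sin x) *: z.
have -> : sin (x + h) *: w + cos (x + h) *: z = y + u.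
  by rewrite /u /y addrACA -!scalerDl ![sin x + _]addrC ![cos x + _]addrC !subrK.
have ur : u = h *: (cos x *: w - sin x *: z) + r.
  rewrite /u /r scalerBr !scalerA addrACA -scaleNr -!scalerDl.
  by congr (_ *: _ + _ *: _); ring.
have a0 := enorm_ge0 w; have b0 := enorm_ge0 z.
have un : enorm u <= `|h| * (enorm w + enorm z).
  apply: (le_trans (enorm_triangle _ _)); rewrite !enormZ mulrDr.
  by apply: lerD; rewrite ler_wpM2r ?sin_lipschitz ?cos_lipschitz.
have rn : enorm r <= h ^+ 2 * (enorm w + enorm z).
  apply: (le_trans (enorm_triangle _ _)); rewrite !enormZ mulrDr.
  by apply: lerD; rewrite ler_wpM2r ?sin_taylor ?cos_taylor.
have Er : dotv (gradient g y) u =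
    h * dotv (gradient g y) (cos x *: w - sin x *: z) + dotv (gradient g y) r.
  by rewrite ur dotvDr dotvZr.
clearbody u r y.
rewrite (_ : _ - _ = (g (y + u) - g y - dotv (gradient g y) u)
  + dotv (gradient g y) r); last first.
  by rewrite Er; ring.
apply: (le_trans (ler_normD _ _)).
have t1 := taylor_lipschitz_gradient dg GL2 y u.
have t2 : `|dotv (gradient g y) r| <= L1 * (h ^+ 2 * (enorm w + enorm z)).
  by apply: (le_trans (dotv_le _ _)); rewrite ler_pM ?enorm_ge0.
have u2 : enorm u ^+ 2 <= h ^+ 2 * (enorm w + enorm z) ^+ 2.
  rewrite -(real_normK (num_real h)) -exprMn ler_pXn2r// nnegrE ?enorm_ge0//.
  by rewrite mulr_ge0// addr_ge0.
have t3 : L2 / 2 * enorm u ^+ 2 <= L2 / 2 * (h ^+ 2 * (enorm w + enorm z) ^+ 2).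
  by rewrite ler_wpM2l// divr_ge0.
apply: (le_trans (lerD (le_trans t1 t3) t2)).
have e1 : (enorm w + enorm z) ^+ 2 <= 1 + 2 * enorm w ^+ 2 + 2 * enorm z ^+ 2.
  by have := sqr_ge0 (enorm w - enorm z); nra.
have e2 : enorm w + enorm z <= 1 + 2 * enorm w ^+ 2 + 2 * enorm z ^+ 2.
  by have := sqr_ge0 (enorm w - 1); have := sqr_ge0 (enorm z - 1); nra.
move: e1 e2; set S := enorm w + enorm z; set X := 1 + _ + _ => e1 e2.
have q0 := sqr_ge0 h.
have -> : h ^+ 2 * (L1 + L2) * X = L2 * (h ^+ 2 * X) + L1 * (h ^+ 2 * X) by ring.
apply: lerD; last by rewrite ler_wpM2l// ler_wpM2l.
apply: (@le_trans _ _ (L2 * (h ^+ 2 * S ^+ 2))).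
  by apply: ler_wpM2r; [rewrite mulr_ge0 ?sqr_ge0|move: L20; lra].
by rewrite ler_wpM2l// ler_wpM2l.
Qed.

(** The path has velocity [cos x w - sin x Z]; the mean of the gradient against [Z] is the trace of
    the kernel. *)
Let dPsi x w : R := cos x * smooth_dot P' Z g (sin x) (cos x) w w
  - sin x * stein_form P' Z g (sin x) (cos x) 1%:M w.

Let Psi_taylor x h w : `|Psi (x + h) w - Psi x w - h * dPsi x w| <=
  h ^+ 2 * (L1 + L2) * (1 + 2 * enorm w ^+ 2 + 2 * k%:R).
Proof.
have [iD ED] := smooth_dotE P' mZ GL1 GL2 (sin x) (cos x) w w.
have [iF EF] := stein_formE mZ gZ GL1 GL2 (sin x) (cos x) 1%:M w.
have [iZ2 EZ2 _ _] := gaussian_enorm_mulmx mZ gZ 1%:M.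
have EZ : \int[P']_t enorm (Z t *m 1%:M) ^+ 2 = k%:R.
  rewrite EZ2 -(sum_delta R k); apply: eq_bigr => a _; apply: eq_bigr => b _.
  by rewrite mxE; case: eqP => _; rewrite ?expr0n ?expr1n.
have i1 := RintegrableB (RintegrableZ (cos x) iD) (RintegrableZ (sin x) iF).
have -> : dPsi x w = \int[P']_t (cos x * dotv (gradient g (sin x *: w + cos x *: Z t)) w
   - sin x * dotv (Z t *m 1%:M) (gradient g (sin x *: w + cos x *: Z t))).
  rewrite (RintegralB measurableT (RintegrableZ (cos x) iD) (RintegrableZ (sin x) iF)).
  by rewrite !RintegralZl// -ED -EF.
have i2 := RintegrableB (iPsi (x + h) w) (iPsi x w).
rewrite -RintegralZl// -RintegralB// -RintegralB//; last exact: (RintegrableZ h i1).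
have i3 := RintegrableD (Rintegrable_cst P' (1 + 2 * enorm w ^+ 2))
  (RintegrableZ 2 iZ2).
apply: (@le_trans _ _ (\int[P']_t (h ^+ 2 * (L1 + L2) *
   (1 + 2 * enorm w ^+ 2 + 2 * enorm (Z t *m 1%:M) ^+ 2)))); last first.
  rewrite (RintegralZl _ measurableT i3).
  rewrite (RintegralD measurableT (Rintegrable_cst P' _) (RintegrableZ 2 iZ2)).
  by rewrite Rintegral_prob_cst (RintegralZl _ measurableT iZ2) EZ.
apply: normr_Rintegral_le.
- exact: Rintegrable_measurable (RintegrableB i2 (RintegrableZ h i1)).
- exact: RintegrableZ i3.
move=> t; rewrite mulmx1; apply: le_trans (rotation_taylor x h w (Z t)).
rewrite le_eqVlt; apply/orP; left; apply/eqP; congr `|_ - _ * _|.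
by rewrite dotvBr !dotvZr [in RHS](dotvC _ (Z t)).
Qed.

Let idPsi x : Int (fun t => dPsi x (W t)) /\
  \int[P]_t dPsi x (W t) =
  cos x * (\sum_i \int[P]_t smooth_dot P' Z g (sin x) (cos x) (W t) (U i t))
  - sin x * \int[P]_t stein_form P' Z g (sin x) (cos x) 1%:M (W t).
Proof.
have E t : smooth_dot P' Z g (sin x) (cos x) (W t) (W t) =
    \sum_i smooth_dot P' Z g (sin x) (cos x) (W t) (U i t).
  rewrite /smooth_dot exchange_big/=; apply: eq_bigr => a _.
  by rewrite -mulr_sumr; congr (_ * _); rewrite /W summxE.
have i1 i : Int (fun t => smooth_dot P' Z g (sin x) (cos x) (W t) (U i t)).
  exact: smooth_dot_integrable.
have i2 : Int (fun t => smooth_dot P' Z g (sin x) (cos x) (W t) (W t)).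
  by under eq_fun do rewrite E; exact: Rintegrable_sum.
have i3 : Int (fun t => stein_form P' Z g (sin x) (cos x) 1%:M (W t)).
  exact: stein_form_integrable.
split; first exact: RintegrableB (RintegrableZ _ i2) (RintegrableZ _ i3).
rewrite RintegralB//; [|exact: RintegrableZ|exact: RintegrableZ].
rewrite !RintegralZl//; congr (_ * _ - _).
by under eq_Rintegral do rewrite E; rewrite Rintegral_sum.
Qed.

Theorem gaussian_approximation_sum :
  `|\int[P]_t g (W t) - \int[P']_t g (Z t)| <=
  L1 / 2 * Num.sqrt (n%:R * (m4 - k%:R / n%:R ^+ 2))
  + L2 / 2 * (n%:R * m3 + k%:R / Num.sqrt n%:R) * pi / 4.
Proof.
pose phi x := \int[P]_t Psi x (W t).
pose phi' x := \int[P]_t dPsi x (W t).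
pose C := (L1 + L2) * \int[P]_t (1 + 2 * enorm (W t) ^+ 2 + 2 * k%:R).
have -> : \int[P]_t g (W t) = phi (pi / 2).
  apply: eq_Rintegral => t _; rewrite /Psi sin_pihalf cos_pihalf.
  under eq_Rintegral do rewrite scale1r scale0r addr0.
  by rewrite Rintegral_prob_cst.
have -> : \int[P']_t g (Z t) = phi 0.
  rewrite /phi -[LHS](Rintegral_prob_cst P); apply: eq_Rintegral => t _.
  by rewrite /Psi sin0 cos0; under [RHS]eq_Rintegral do rewrite scale1r scale0r add0r.
have iP x : Int (fun t => Psi x (W t)).
  apply: (@Rintegrable_bounded _ _ _ _ _ B).
    exact: (@measurableT_comp _ _ _ _ _ _ (Psi x) _ W).
  move=> t; rewrite -(Rintegral_prob_cst P' B); apply: normr_Rintegral_le => //.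
  - exact: Rintegrable_measurable (iPsi x (W t)).
  - exact: Rintegrable_cst.
have iC : Int (fun t => 1 + 2 * enorm (W t) ^+ 2 + 2 * k%:R).
  have i1 := RintegrableD (Rintegrable_cst P 1) (RintegrableZ 2 iW2).
  exact: RintegrableD i1 (Rintegrable_cst _ _).
apply: (@sinusoidal_interpolation _ phi phi' C) => [x h|x s0 c0].
  have i1 := RintegrableB (iP (x + h)) (iP x).
  have i2 := (idPsi x).1.
  rewrite /phi /phi' -RintegralB// -RintegralZl//.
  rewrite -(RintegralB measurableT i1 (RintegrableZ h i2)).
  rewrite /C mulrC mulrA -RintegralZl//.
  apply: normr_Rintegral_le => [||t].
  - exact: Rintegrable_measurable (RintegrableB i1 (RintegrableZ h i2)).
  - exact: RintegrableZ.
  - exact: Psi_taylor.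
rewrite /phi' (idPsi x).2.
(* Half the sum of two bounds on the same quantity: the [L1] term, linear in [sin x], and the terms
   [k] and [m3], in [sin x ^ 2], take their final coefficients here. *)
have := interpolation_bound_V (sin x) (cos x).
have := interpolation_bound_W (sin x) (cos x).
rewrite (ger0_norm s0); lra.
Qed.

End SumOfIndependent.

(** * The constants *)

(* If [pi / 2 >= 7 / 4] then [cos (7 / 4) >= 0], whereas
   [cos (7 / 4) = 1 - 2 * sin (7 / 8) ^ 2 < 0] by [sin x >= x - x ^ 3 / 6]. *)
Lemma pi_le72 (R : realType) : pi <= 7 / 2 :> R.
Proof.
have sin_ub (x : R) : 0 <= x -> sin x <= x.
  move=> x0; have := @increment_le R _ _ _ _ 0 x x0 (@is_derive_sin R)
    (fun y => is_derive_id _ _) (fun y _ => cos_le1 y).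
  by rewrite sin0 !subr0.
have cos_lb (x : R) : 0 <= x -> 1 - x ^+ 2 / 2 <= cos x.
  move=> x0; have dq (y : R) : is_derive y (1 : R) (fun z : R => z ^+ 2 / 2) y.
    by apply: is_derive_eq; rewrite /GRing.scale/=; lra.
  have ndc (y : R) : is_derive y (1 : R) (- cos) (sin y).
    by apply: is_derive_eq; rewrite opprK.
  have := @increment_le R _ _ _ _ 0 x x0 ndc dq
    (fun y yx => sin_ub y (andP yx).1).
  rewrite -[(- cos) x]/(- cos x) -[(- cos) 0]/(- cos 0) cos0; lra.
have sin_lb (x : R) : 0 <= x -> x - x ^+ 3 / 6 <= sin x.
  move=> x0; have dq (y : R) : is_derive y (1 : R)
      (fun z : R => z - z ^+ 3 / 6) (1 - y ^+ 2 / 2).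
    by apply: is_derive_eq; rewrite /GRing.scale/=; field.
  have := @increment_le R _ _ _ _ 0 x x0 dq (@is_derive_sin R)
    (fun y yx => cos_lb y (andP yx).1).
  by rewrite sin0 expr0n/= mul0r !subr0.
rewrite leNgt; apply/negP => pi72.
have := @cos_ge0_pihalf R (7 / 4); rewrite (_ : _ <= _ <= _); last first.
  by apply/andP; split; lra.
move=> /(_ isT); rewrite (_ : 7 / 4 = (7 / 8) *+ 2 :> R); last by rewrite mulr2n; lra.
rewrite cos_mulr2n cos2sin2; have := sin_lb (7 / 8) ltac:(lra).
rewrite mulr2n => h1 h2.
have : 3 / 4 <= sin (7 / 8 : R) by move: h1; lra.
by move=> h3; nra.
Qed.

(** * The suprema [M1] and [M2] as Lipschitz constants *)

Section Lipschitz_constants.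
Context {R : realType} {k : nat}.
Variable g : 'rV[R]_k -> R.

Lemma enorm_sub_gt0 (x y : 'rV[R]_k) : x != y -> 0 < enorm (x - y).
Proof.
move=> xy; rewrite lt_def enorm_ge0 andbT; apply: contra_neq xy => /enorm_eq0/eqP.
by rewrite subr_eq0 => /eqP.
Qed.

Lemma const_mx1_neq0 : (0 < k)%N -> const_mx 1 != 0 :> 'rV[R]_k.
Proof.
move=> k0; apply/eqP => /matrixP/(_ 0 (Ordinal k0)); rewrite !mxE => /eqP.
by rewrite oner_eq0.
Qed.

Lemma M1_lipschitz L : M1 g = L%:E ->
  forall x y, `|g x - g y| <= L * enorm (x - y).
Proof.
move=> ML x y; have [->|xy] := eqVneq x y.
  by rewrite !subrr normr0 enorm0 mulr0.
have e0 := enorm_sub_gt0 xy.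
rewrite -ler_pdivrMr// -lee_fin -ML; apply: ereal_sup_ubound.
by exists (x, y).
Qed.

Lemma M2_lipschitz L : M2 g = L%:E ->
  forall x y, enorm (gradient g x - gradient g y) <= L * enorm (x - y).
Proof.
move=> ML x y; have [->|xy] := eqVneq x y.
  by rewrite !subrr enorm0 mulr0.
have e0 := enorm_sub_gt0 xy.
rewrite -ler_pdivrMr// -lee_fin -ML; apply: ereal_sup_ubound.
by exists (x, y).
Qed.

Lemma M1_le L : (forall x y, `|g x - g y| <= L * enorm (x - y)) ->
  (M1 g <= L%:E)%E.
Proof.
move=> gL; apply: ge_ereal_sup => _ [[x y] /= xy <-].
have e0 := enorm_sub_gt0 xy.
by rewrite lee_fin ler_pdivrMr.
Qed.

(** Two distinct points are needed: for [k = 0] the supremum is over the empty set and equals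
    [-oo]. *)
Lemma M1_ge0 : (0 < k)%N -> (0 <= M1 g)%E.
Proof.
move=> k0; pose x : 'rV[R]_k := const_mx 1; have x0 : x != 0 by exact: const_mx1_neq0.
apply: (@le_trans _ _ (`|g x - g 0| / enorm (x - 0))%:E).
  by rewrite lee_fin divr_ge0 ?enorm_ge0.
by apply: ereal_sup_ubound; exists (x, 0).
Qed.

Lemma M2_ge0 : (0 < k)%N -> (0 <= M2 g)%E.
Proof.
move=> k0; pose x : 'rV[R]_k := const_mx 1; have x0 : x != 0 by exact: const_mx1_neq0.
apply: (@le_trans _ _ (enorm (gradient g x - gradient g 0) / enorm (x - 0))%:E).
  by rewrite lee_fin divr_ge0 ?enorm_ge0.
by apply: ereal_sup_ubound; exists (x, 0).
Qed.

(** A small step [h v] along a gradient [v] longer than [L1] would increase [g] by more than [L1]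
    times the length of the step. *)
Lemma gradient_le_lipschitz L1 L2 : 0 <= L1 -> 0 <= L2 ->
  (forall x, differentiable g x) ->
  (forall x y, `|g x - g y| <= L1 * enorm (x - y)) ->
  (forall x y, enorm (gradient g x - gradient g y) <= L2 * enorm (x - y)) ->
  forall x, enorm (gradient g x) <= L1.
Proof.
move=> L10 L20 dg gL GL x; set v := gradient g x; rewrite leNgt; apply/negP => Lv.
have vp : 0 < enorm v := le_lt_trans L10 Lv.
(* Chosen so that [L2 h |v| < |v| - L1], which beats the Taylor error [L2 h |v| / 2]; the added 1
   covers [L2 = 0]. *)
pose h := (enorm v - L1) / (L2 * enorm v + 1).
have D0 : 0 < L2 * enorm v + 1 by rewrite ltr_wpDl// mulr_ge0// ltW.
have h0 : 0 < h by rewrite divr_gt0// subr_gt0.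
have hE : h * (L2 * enorm v + 1) = enorm v - L1 by rewrite /h divfK// gt_eqF.
have := taylor_lipschitz_gradient dg GL x (h *: v).
have := gL (x + h *: v) x.
rewrite addrAC subrr add0r dotvZr -sqr_enorm !enormZ (ger0_norm (ltW h0)).
rewrite !ler_norml => /andP[_ a1] /andP[a2 _].
have : h * enorm v * (enorm v - L1) <= h * enorm v * (L2 / 2 * (h * enorm v)).
  by move: a1 a2; rewrite -/v !expr2; nra.
rewrite (ler_pM2l (mulr_gt0 h0 vp)) => h1.
by have := mulr_ge0 L20 (ltW (mulr_gt0 h0 vp)); move: h1 hE h0; lra.
Qed.

End Lipschitz_constants.

Lemma compact_support_bounded (R : realType) (k : nat) (g : 'rV[R]_k -> R) :
  C2o g -> exists B, forall x, `|g x| <= B.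
Proof.
move=> [[dg _ _] cs].
have cg : continuous g by move=> x; exact: differentiable_continuous.
have [M [_ gM]] := compact_bounded (continuous_compact (continuous_subspaceT cg) cs).
(* Every number above [M] bounds [g] on the support, hence [M + 1]; the maximum with 0 covers the
   points where [g] vanishes. *)
exists (Num.max (M + 1) 0) => x; have [->|gx] := eqVneq (g x) 0.
  by rewrite normr0 le_max lexx orbT.
rewrite le_max; apply/orP; left; apply: (gM (M + 1)); first by rewrite ltrDl.
by exists x => //; exact: subset_closure.
Qed.

Lemma mutually_independent_comp (R : realType) d d1 d2 (T : measurableType d)
    (T1 : measurableType d1) (T2 : measurableType d2) (P : probability T R)
    (I : finType) (X : I -> T -> T1) (f : T1 -> T2) :
  measurable_fun setT f -> mutually_independent P X ->
  mutually_independent P (fun i => f \o X i).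
Proof.
move=> mf iX J B mB; apply: (iX J (fun i => f @^-1` B i)) => i.
by rewrite -[_ @^-1` _]setTI; exact: mf.
Qed.

(** * Rescaling to the normalized sum *)

Section MomentBounds.
Context {R : realType} {k n : nat} (n0 : (0 < n)%N) (k0 : (0 < k)%N)
  d (T : measurableType d) (P : probability T R) (Y : 'I_n -> T -> 'rV[R]_k)
  d' (T' : measurableType d') (P' : probability T' R) (Z : T' -> 'rV[R]_k).
Notation Int f := (P.-integrable setT (EFin \o f)).
Hypothesis mY : forall i, measurable_fun setT (Y i).
Hypothesis iY : mutually_independent P Y.
Hypothesis Y1 : forall i a, Int (fun t => Y i t 0 a) /\ \int[P]_t Y i t 0 a = 0.
Hypothesis Y2 : forall i a b, Int (fun t => Y i t 0 a * Y i t 0 b) /\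
  \int[P]_t (Y i t 0 a * Y i t 0 b) = (a == b)%:R.
Variables m3 m4 : R.
Hypothesis Y3 : forall i, Int (fun t => enorm (Y i t) ^+ 3) /\
  \int[P]_t enorm (Y i t) ^+ 3 = m3.
Hypothesis Y4 : forall i, Int (fun t => enorm (Y i t) ^+ 4) /\
  \int[P]_t enorm (Y i t) ^+ 4 = m4.

(** From [x ^ 3 - 3 / 2 x ^ 2 + 1 / 2 = (x - 1) ^ 2 (x + 1 / 2) >= 0] and [E |Y| ^ 2 = k] the third
    moment is at least [(3 k - 1) / 2], which is at least [k] because [k >= 1]. *)
Lemma dim_le_third_moment : k%:R <= m3.
Proof.
pose i0 := Ordinal n0; have [i3 <-] := Y3 i0.
have i2 : Int (fun t => enorm (Y i0 t) ^+ 2).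
  under eq_fun do rewrite sqr_enorm.
  by apply: Rintegrable_sum => a; exact: (Y2 i0 a a).1.
have E2 : \int[P]_t enorm (Y i0 t) ^+ 2 = k%:R.
  under eq_Rintegral do rewrite sqr_enorm.
  rewrite Rintegral_sum => [|a]; last exact: (Y2 i0 a a).1.
  under eq_bigr do rewrite (Y2 i0 _ _).2 eqxx.
  by rewrite sumr_const card_ord.
have ih := RintegrableB (RintegrableZ (3 / 2) i2) (Rintegrable_cst P (1 / 2)).
apply: (@le_trans _ _ (\int[P]_t (3 / 2 * enorm (Y i0 t) ^+ 2 - 1 / 2))).
  rewrite (RintegralB measurableT (RintegrableZ (3 / 2) i2) (Rintegrable_cst P _)).
  rewrite (RintegralZl _ measurableT i2) E2 Rintegral_prob_cst.
  by have : 1 <= k%:R :> R by [rewrite ler1n]; lra.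
apply: le_Rintegral => // t _; have := enorm_ge0 (Y i0 t).
move: (enorm _) => x x0; have : 0 <= (x - 1) ^+ 2 * (x + 1 / 2).
  by rewrite mulr_ge0 ?sqr_ge0//; lra.
by rewrite !exprS !expr0 !mulr1; lra.
Qed.

Hypothesis mZ : measurable_fun setT Z.
Hypothesis gZ : standard_gaussian P' Z.
Variables (g : 'rV[R]_k -> R) (B L1 L2 : R).
Hypothesis dg : forall x, differentiable g x.
Hypothesis gB : forall x, `|g x| <= B.
Hypothesis GL1 : forall x, enorm (gradient g x) <= L1.
Hypothesis GL2 : forall x y,
  enorm (gradient g x - gradient g y) <= L2 * enorm (x - y).
Hypothesis L20 : 0 <= L2.

Lemma gaussian_approximation_normalized_sum :
  `|\int[P]_t g ((Num.sqrt n%:R)^-1 *: \sum_i Y i t) - \int[P']_t g (Z t)| <=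
  L1 * (2 * Num.sqrt n%:R)^-1 * Num.sqrt (m4 - k%:R)
  + Num.sqrt (2 * pi) / (3 * Num.sqrt n%:R) * L2 * m3.
Proof.
have n0' : 0 < n%:R :> R by rewrite ltr0n.
set q : R := Num.sqrt n%:R.
have q0 : 0 < q by rewrite sqrtr_gt0.
have qn : q != 0 by rewrite gt_eqF.
have q2 : q ^+ 2 = n%:R by rewrite sqr_sqrtr// ltW.
have nE (j : nat) x : enorm (q^-1 *: x) ^+ j = q^-1 ^+ j * enorm x ^+ j :> R.
  by rewrite enormZ exprMn ger0_norm// invr_ge0 ltW.
have U0 : mutually_independent P (fun i t => q^-1 *: Y i t).
  apply: (@mutually_independent_comp _ _ _ _ _ _ _ P _ Y (fun x => q^-1 *: x)) => //.
  apply: measurable_rV => a; under eq_fun do rewrite mxE.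
  apply: measurable_funM => //; exact: (measurable_coord a (@measurable_id _ _ setT)).
have mU i : measurable_fun setT (fun t => q^-1 *: Y i t).
  apply: measurable_rV => a; under eq_fun do rewrite mxE.
  by apply: measurable_funM => //; exact: measurable_coord.
have U1 i a : Int (fun t => (q^-1 *: Y i t) 0 a) /\ \int[P]_t (q^-1 *: Y i t) 0 a = 0.
  have [i1 E1] := Y1 i a; under eq_fun do rewrite mxE.
  by rewrite (RintegralZl _ measurableT i1) E1 mulr0; split=> //; exact: RintegrableZ.
have U2 i a b : Int (fun t => (q^-1 *: Y i t) 0 a * (q^-1 *: Y i t) 0 b) /\
    \int[P]_t ((q^-1 *: Y i t) 0 a * (q^-1 *: Y i t) 0 b) = (a == b)%:R / n%:R.
  have [i2 E2] := Y2 i a b.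
  have E t : (q^-1 *: Y i t) 0 a * (q^-1 *: Y i t) 0 b =
      n%:R^-1 * (Y i t 0 a * Y i t 0 b).
    by rewrite !mxE -q2; field.
  rewrite (funext E) (RintegralZl _ measurableT i2) E2 mulrC; split=> //.
  exact: RintegrableZ.
have Uj j m : (forall i, Int (fun t => enorm (Y i t) ^+ j) /\
      \int[P]_t enorm (Y i t) ^+ j = m) -> forall i,
    Int (fun t => enorm (q^-1 *: Y i t) ^+ j) /\
      \int[P]_t enorm (q^-1 *: Y i t) ^+ j = q^-1 ^+ j * m.
  move=> Yj i; have [ij Ej] := Yj i; under eq_fun do rewrite nE.
  by rewrite (RintegralZl _ measurableT ij) Ej; split=> //; exact: RintegrableZ.
have := gaussian_approximation_sum n0 mU U0 U1 U2 (Uj _ _ Y3) (Uj _ _ Y4)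
  mZ gZ dg gB GL1 GL2 L20.
under [X in X - _]eq_Rintegral do rewrite -scaler_sumr.
move=> /le_trans; apply; apply: lerD.
  rewrite -/q (_ : n%:R * _ = (q^-1) ^+ 2 * (m4 - k%:R)); last by rewrite -q2; field.
  rewrite sqrtrM ?sqr_ge0// sqrtr_sqr ger0_norm ?invr_ge0 ?(ltW q0)//.
  by rewrite le_eqVlt; apply/orP; left; apply/eqP; field.
have km := dim_le_third_moment.
have m30 : 0 <= m3 := le_trans (ler0n _ _) km.
(* Squared, this says [pi <= 32 / 9], and [7 / 2] lies below [32 / 9]. *)
have ps : pi / 4 <= Num.sqrt (2 * pi) / 3 :> R.
  have p0 := @pi_ge0 R.
  rewrite -(@ler_pXn2r _ 2) ?nnegrE ?divr_ge0 ?sqrtr_ge0//.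
  rewrite !expr_div_n sqr_sqrtr ?mulr_ge0//.
  by have := @pi_le72 R; nra.
rewrite -/q (_ : n%:R * (q^-1 ^+ 3 * m3) + k%:R / q = (m3 + k%:R) / q); last first.
  by rewrite -q2; field.
(* Here [k <= m3] bounds the average [(m3 + k) / 2] by [m3]. *)
apply: (@le_trans _ _ (L2 * m3 / q * (pi / 4))).
  rewrite -[leLHS]mulrA ler_wpM2r ?divr_ge0 ?pi_ge0//.
  rewrite mulrA ler_wpM2r ?invr_ge0 ?(ltW q0)//.
  by have := mulr_ge0 L20 m30; have := ler_wpM2l L20 km; lra.
apply: (le_trans (ler_wpM2l _ ps)).
  by rewrite !mulr_ge0 ?invr_ge0 ?(ltW q0).
by rewrite le_eqVlt; apply/orP; left; apply/eqP; field.
Qed.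

End MomentBounds.

(** * Extended-real form *)

Lemma expectation_Rintegral (R : realType) d (T : measurableType d)
    (P : probability T R) (f : T -> R) :
  P.-integrable setT (EFin \o f) -> 'E_P[f]%E = (\int[P]_t f t)%:E.
Proof. by move=> fi; rewrite unlock /Rintegral fineK//; exact: integrable_fin_num. Qed.

Lemma identically_distributed_expectation (R : realType) d d1 (T : measurableType d)
    (T1 : measurableType d1) (P : probability T R) (I : Type) (X : I -> T -> T1)
    (f : T1 -> R) (i j : I) :
  (forall i, measurable_fun setT (X i)) -> identically_distributed P X ->
  measurable_fun setT f -> (forall x, 0 <= f x) ->
  'E_P[fun t => f (X i t)]%E = 'E_P[fun t => f (X j t)]%E.
Proof.
move=> mX dX mf f0; rewrite unlock.
pose D l : {mfun T >-> T1} :=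
  HB.pack (X l) (isMeasurableFun.Build _ _ _ _ (X l) (mX l)).
have mEf : measurable_fun setT (EFin \o f) by exact/measurable_EFinP.
have E l : (\int[P]_t (f (X l t))%:E = \int[distribution P (D l)]_x (f x)%:E)%E.
  by rewrite ge0_integral_distribution.
rewrite !E; apply: eq_measure_integral => A mA _; exact: dX.
Qed.

Theorem theorem7 (R : realType) (k n : nat) (hn : (0 < n)%N)
    (d : measure_display) (T : measurableType d) (P : probability T R)
    (Y : 'I_n -> {RV P >-> 'rV[R]_k})
    (hindep : mutually_independent P (fun i => Y i : T -> 'rV[R]_k))
    (hident : identically_distributed P (fun i => Y i : T -> 'rV[R]_k))
    (hmean : forall i, has_mean P (Y i) 0)
    (hcov : forall i, has_mean P (fun t => (Y i t)^T *m Y i t) 1%:M)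
    (d' : measure_display) (T' : measurableType d') (P' : probability T' R)
    (Z : {RV P' >-> 'rV[R]_k}) (hZ : standard_gaussian P' Z)
    (g : 'rV[R]_k -> R) (hg : C2o g) :
  let W := fun t => (Num.sqrt n%:R)^-1 *: \sum_(i < n) Y i t in
  let Y1 := Y (Ordinal hn) in
  (`| 'E_P[g \o W] - 'E_P'[g \o Z] | <=
     M1 g * ((2 * Num.sqrt n%:R)^-1)%:E
       * sqrte ('E_P[fun t => (enorm (Y1 t) ^+ 4)%R] - k%:R%:E)
     + (Num.sqrt (2 * pi) / (3 * Num.sqrt n%:R))%:E * M2 g
       * 'E_P[fun t => (enorm (Y1 t) ^+ 3)%R])%E.
Proof.
pose W (t : T) : 'rV[R]_k := (Num.sqrt n%:R)^-1 *: \sum_(i < n) Y i t.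
pose Y1 := Y (Ordinal hn).
change (`| 'E_P[g \o W] - 'E_P'[g \o Z] | <=
  M1 g * ((2 * Num.sqrt n%:R)^-1)%:E
    * sqrte ('E_P[fun t => (enorm (Y1 t) ^+ 4)%R] - k%:R%:E)
  + (Num.sqrt (2 * pi) / (3 * Num.sqrt n%:R))%:E * M2 g
    * 'E_P[fun t => (enorm (Y1 t) ^+ 3)%R])%E.
have gcst : (forall x y, g x = g y) -> (`| 'E_P[g \o W] - 'E_P'[g \o Z] | = 0)%E.
  move=> gE; rewrite (_ : g \o W = cst (g 0)); last by apply/funext => t; exact: gE.
  rewrite (_ : g \o Z = cst (g 0)); last by apply/funext => t; exact: gE.
  by rewrite !expectation_cst subee// abse0.
(* For [k = 0] both suprema are [-oo], but the moments vanish and both products are 0. *)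
have [k0|k0] := posnP k.
  have no_index (b : 'I_k) : False by case: b => b; rewrite k0.
  rewrite gcst; last by move=> x y; congr g; apply/matrixP => a b; case: (no_index b).
  have e0 (x : 'rV[R]_k) : enorm x = 0.
    by rewrite /enorm big1 ?sqrtr0// => b _; case: (no_index b).
  have Ej j : (0 < j)%N -> ('E_P[fun t => (enorm (Y1 t) ^+ j)%R] = 0)%E.
    move=> j0; rewrite (_ : (fun t => _) = cst 0) ?expectation_cst//.
    by apply/funext => t; rewrite e0 expr0n (gtn_eqF j0).
  have kR : k%:R = 0 :> R by rewrite k0.
  by rewrite !Ej// kR sub0e oppe0 sqrte0 !mule0 adde0.
have n0 : 0 < n%:R :> R by rewrite ltr0n.
have q0 : 0 < Num.sqrt n%:R :> R by rewrite sqrtr_gt0.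
have mY i : measurable_fun setT (Y i) by [].
have mZ : measurable_fun setT Z by [].
set E4 := ('E_P[fun t => (enorm (Y1 t) ^+ 4)%R])%E.
set E3 := ('E_P[fun t => (enorm (Y1 t) ^+ 3)%R])%E.
have E30 : (0 <= E3)%E by apply: expectation_ge0 => t; rewrite exprn_ge0 ?enorm_ge0.
have E40 : (0 <= E4)%E by apply: expectation_ge0 => t; rewrite exprn_ge0 ?enorm_ge0.
have M10 := M1_ge0 g k0; have M20 := M2_ge0 g k0.
have term2_ge0 : (0 <= (Num.sqrt (2 * pi) / (3 * Num.sqrt n%:R))%:E * M2 g * E3)%E.
  rewrite mule_ge0// mule_ge0// lee_fin divr_ge0 ?sqrtr_ge0// mulr_ge0// ltW//.
have c1 : 0 < (2 * Num.sqrt n%:R)^-1 :> R by rewrite invr_gt0 mulr_gt0.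
have term1_ge0 : (0 <= M1 g * ((2 * Num.sqrt n%:R)^-1)%:E * sqrte (E4 - k%:R%:E))%E.
  by rewrite mule_ge0 ?sqrte_ge0// mule_ge0// lee_fin ltW.
(* Settled before the fourth moment is examined: as [0 * +oo = 0], an infinite moment would not make
   the first term infinite when [M1 g = 0]. Then [g] is constant. *)
have [M1z|M1nz] := eqVneq (M1 g) 0%E.
  rewrite gcst ?adde_ge0// => x y.
  have := M1_lipschitz M1z x y; rewrite mul0r normr_le0 subr_eq0 => /eqP.
  by [].
have M1p : (0 < M1 g)%E by rewrite lt_def M1nz.
have [E4oo|E4fin] := eqVneq E4 +oo%E.
  rewrite E4oo addye//= muleC gt0_mulye ?mule_gt0//.
  rewrite addye ?leey// gt_eqF// (lt_le_trans _ term2_ge0)// ltNy0.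
have mnorm j : measurable_fun setT (fun x : 'rV[R]_k => enorm x ^+ j).
  by apply: measurable_funX; exact: measurable_enorm.
have Edist j i : ('E_P[fun t => (enorm (Y i t) ^+ j)%R] =
    'E_P[fun t => (enorm (Y1 t) ^+ j)%R])%E.
  apply: (identically_distributed_expectation (X := fun i => Y i : T -> 'rV[R]_k)
    (f := fun x => enorm x ^+ j)) => // x.
  by rewrite exprn_ge0 ?enorm_ge0.
have mYj i j : measurable_fun setT (fun t => enorm (Y i t) ^+ j).
  exact: (@measurableT_comp _ _ _ _ _ _ (fun x => enorm x ^+ j) _ (Y i)).
have i4 i : P.-integrable setT (EFin \o (fun t => enorm (Y i t) ^+ 4)).
  apply/integrableP; split; first exact/measurable_EFinP.
  rewrite (eq_integral (fun t => (enorm (Y i t) ^+ 4)%:E)); last first.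
    by move=> t _; rewrite /= ger0_norm ?exprn_ge0 ?enorm_ge0.
  by have := Edist 4%N i; rewrite {1}unlock => ->; rewrite ltey.
(* A single integrable majorant for all the lower moments; only with integrability do the hypotheses
   on means become equations between real integrals. *)
have i14 i : P.-integrable setT (EFin \o (fun t => 1 + enorm (Y i t) ^+ 4)).
  exact: RintegrableD (Rintegrable_cst P 1) (i4 i).
have x4 (x : R) : 0 <= x ->
    [/\ x <= 1 + x ^+ 4, x ^+ 2 <= 1 + x ^+ 4 & x ^+ 3 <= 1 + x ^+ 4].
  move=> x0; have := sqr_ge0 (x ^+ 2 - 1 / 2); have := sqr_ge0 (x - 1 / 2).
  have := sqr_ge0 (x ^+ 2 - x); rewrite !exprS !expr0 !mulr1 => h1 h2 h3.
  by split; lra.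
have i3 i : P.-integrable setT (EFin \o (fun t => enorm (Y i t) ^+ 3)).
  apply: (Rintegrable_dominated _ _ (i14 i)) => // t.
  have [_ _] := x4 _ (enorm_ge0 (Y i t)).
  by rewrite ger0_norm ?exprn_ge0 ?enorm_ge0.
have R4 i : P.-integrable setT (EFin \o (fun t => enorm (Y i t) ^+ 4)) /\
    \int[P]_t enorm (Y i t) ^+ 4 = fine E4.
  by split=> //; rewrite -[LHS]/(fine (_%:E)) -expectation_Rintegral// Edist.
have R3 i : P.-integrable setT (EFin \o (fun t => enorm (Y i t) ^+ 3)) /\
    \int[P]_t enorm (Y i t) ^+ 3 = fine E3.
  by split=> //; rewrite -[LHS]/(fine (_%:E)) -expectation_Rintegral// Edist.
have R1 i a : P.-integrable setT (EFin \o (fun t => Y i t 0 a)) /\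
    \int[P]_t Y i t 0 a = 0.
  have i1 : P.-integrable setT (EFin \o (fun t => Y i t 0 a)).
    apply: (Rintegrable_dominated _ _ (i14 i)); first exact: measurable_coord.
    move=> t; have [h _ _] := x4 _ (enorm_ge0 (Y i t)).
    exact: le_trans (coord_le_enorm _ _) h.
  split=> //; have := hmean i 0 a; rewrite expectation_Rintegral// mxE.
  by move=> [].
have R2 i a b : P.-integrable setT (EFin \o (fun t => Y i t 0 a * Y i t 0 b)) /\
    \int[P]_t (Y i t 0 a * Y i t 0 b) = (a == b)%:R.
  have i2 : P.-integrable setT (EFin \o (fun t => Y i t 0 a * Y i t 0 b)).
    apply: (Rintegrable_dominated _ _ (i14 i)).
      by apply: measurable_funM; exact: measurable_coord.
    move=> t; have [_ h _] := x4 _ (enorm_ge0 (Y i t)).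
    by apply: le_trans h; rewrite normrM expr2 ler_pM// coord_le_enorm.
  split=> //; have := hcov i a b.
  rewrite (_ : (fun t => _) = (fun t => Y i t 0 a * Y i t 0 b)); last first.
    by apply/funext => t; rewrite !mxE big_ord1 mxE.
  by rewrite expectation_Rintegral// mxE => -[].
have km := dim_le_third_moment hn k0 R2 R3.
have E3E : E3 = (fine E3)%:E by rewrite -(R3 (Ordinal hn)).2 -expectation_Rintegral.
have E4E : E4 = (fine E4)%:E by rewrite -(R4 (Ordinal hn)).2 -expectation_Rintegral.
(* An infinite [M2 g] makes the second term [+oo], because the third moment is at least [k > 0]. *)
have [M2oo|M2fin] := eqVneq (M2 g) +oo%E.
  rewrite M2oo gt0_muley; last first.
    by rewrite lte_fin divr_gt0 ?mulr_gt0// sqrtr_gt0 mulr_gt0// pi_gt0.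
  rewrite E3E gt0_mulye; last by rewrite lte_fin (lt_le_trans _ km)// ltr0n.
  by rewrite addey ?leey// gt_eqF// (lt_le_trans _ term1_ge0)// ltNy0.
have M2E : M2 g = (fine (M2 g))%:E by rewrite fineK// ge0_fin_numE// ltey.
have L20 : 0 <= fine (M2 g) by rewrite fine_ge0.
have GL2 := M2_lipschitz M2E.
have [B gB] := compact_support_bounded hg.
have dg : forall x, differentiable g x by case: hg => -[].
have GB := bounded_gradient dg GL2 L20 gB.
have M1E : M1 g = (fine (M1 g))%:E.
  rewrite fineK// ge0_fin_numE//.
  apply: (@le_lt_trans _ _ (2 * B + fine (M2 g) / 2)%:E); last exact: ltry.
  by apply: M1_le => x y; exact: (bounded_gradient_lipschitz dg _ _ GB).
have L10 : 0 <= fine (M1 g) by rewrite fine_ge0.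
(* The crude gradient bound served only to make [M1 g] finite; the bound is now sharpened to [M1 g]
   itself. *)
have GL1 := gradient_le_lipschitz L10 L20 dg (M1_lipschitz M1E) GL2.
have mg : measurable_fun setT g.
  by apply: continuous_measurable_matrix => x; exact: differentiable_continuous.
have mW : measurable_fun setT W.
  apply: measurable_rV => a; under eq_fun do rewrite mxE summxE.
  apply: measurable_funM => //; apply: measurable_sum => i; exact: measurable_coord.
have igW : P.-integrable setT (EFin \o (g \o W)).
  apply: (@Rintegrable_bounded _ _ _ _ _ B) => [|t]; last exact: gB.
  exact: (@measurableT_comp _ _ _ _ _ _ g _ W).
have igZ : P'.-integrable setT (EFin \o (g \o Z)).
  apply: (@Rintegrable_bounded _ _ _ _ _ B) => [|t]; last exact: gB.
  exact: (@measurableT_comp _ _ _ _ _ _ g _ Z).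
rewrite (expectation_Rintegral igW) (expectation_Rintegral igZ).
rewrite E3E E4E M1E M2E /= -!EFinM -EFinD lee_fin.
exact: (gaussian_approximation_normalized_sum hn k0 mY hindep R1 R2 R3 R4
  mZ hZ dg gB GL1 GL2 L20).
Qed.
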